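(* Let $\lambda\in Q_+$ and $\tilde w\in\mathbb{O}_\lambda$. Then for every conjugacy class $\mathbb{O}$ of $\widetilde W$, $$\deg(f_{\tilde w,\mathbb{O}})=\begin{cases}0,&\mathbb{O}=\mathbb{O}_\lambda,\\-\infty,&\text{otherwise}.\end{cases}$$
   Context: Type $C_2$ data: simple roots $\alpha_1=(1,-1)$, $\alpha_2=(0,2)$ in $\mathbb{R}^2$; $\epsilon_1=(1,0)$, $\epsilon_2=(\frac12,\frac12)$, $\Lambda_1=\epsilon_1$, $\Lambda_2=2\epsilon_2$; $P=\mathbb{Z}\epsilon_1\oplus\mathbb{Z}\epsilon_2$, $Q=\mathbb{Z}\Lambda_1\oplus\mathbb{Z}\Lambda_2$. $W=\langle s_1,s_2\rangle$ is the Weyl group (dihedral of order 8): $s_1(\Lambda_1)=\Lambda_2-\Lambda_1$, $s_1(\Lambda_2)=\Lambda_2$, $s_2(\Lambda_1)=\Lambda_1$, $s_2(\Lambda_2)=2\Lambda_1-\Lambda_2$. $\widetilde W=P\rtimes W$, with $t^\lambda$ the translation by $\lambda$. $W_a=Q\rtimes W$ is the Coxeter group generated by $\widetilde{\mathbb{S}}=\{s_0,s_1,s_2\}$, $s_0=t^{\Lambda_1}s_1s_2s_1$. $\tau=t^{\epsilon_2}s_2s_1s_2$ satisfies $\tau^2=1$, $\tau s_0\tau^{-1}=s_2$, $\tau s_1\tau^{-1}=s_1$, and $\widetilde W=W_a\rtimes\{1,\tau\}$. $\ell$ is the Coxeter length on $W_a$, extended by $\ell(x\tau)=\ell(x)$.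 $\mathbb{N}=\{0,1,2,\dots\}$. $Q_+=\{m\Lambda_1+n\Lambda_2\mid m,n\in\mathbb{N}\}$ is the set of dominant elements of $Q$, and $\mathbb{O}_\lambda=\{t^{w(\lambda)}\mid w\in W\}$, a conjugacy class of $\widetilde W$. Class polynomials: $A=\mathbb{Z}[v,v^{-1}]$; $\widetilde H$ is the associative $A$-algebra with basis $T_{\tilde w}$ ($\tilde w\in\widetilde W$) and relations $T_{\tilde x}T_{\tilde y}=T_{\tilde x\tilde y}$ if $\ell(\tilde x)+\ell(\tilde y)=\ell(\tilde x\tilde y)$, $(T_s-v)(T_s+v^{-1})=0$ for $s\in\widetilde{\mathbb{S}}$. $[\widetilde H,\widetilde H]$ is the $A$-submodule generated by all $hh'-h'h$. For a conjugacy class $\mathbb{O}$ of $\widetilde W$, $T_{\mathbb{O}}$ denotes the image in $\widetilde H/[\widetilde H,\widetilde H]$ of $T_x$ for any minimal length element $x\in\mathbb{O}$ (independent of the choice); the $T_{\mathbb{O}}$ form an $A$-basis of $\widetilde H/[\widetilde H,\widetilde H]$ (He–Nie). The class polynomials $f_{\tilde w,\mathbb{O}}\in A$ are defined by $T_{\tilde w}\equiv\sum_{\mathbb{O}}f_{\tilde w,\mathbb{O}}T_{\mathbb{O}}$ modulo $[\widetilde H,\widetilde H]$; they are polynomials in $v-v^{-1}$, $\deg$ is the degree in $v-v^{-1}$, and $\deg 0=-\infty$. *)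

(* Defs.v *)
From HB Require Import structures.
From mathcomp Require Import all_boot all_order all_algebra.
From mathcomp Require Import monoid.
From mathcomp Require Import all_classical.
From mathcomp Require Import constructive_ereal.
Set Implicit Arguments.
Unset Strict Implicit.
Unset Printing Implicit Defensive.
Import Order.TTheory GRing.Theory Num.Theory.
Local Open Scope classical_set_scope.
Local Open Scope ring_scope.

(* The weight lattice P = Z eps1 + Z eps2, in coordinates with respect to the *)
(* basis (eps1, eps2): the column vector (a, b)^T is a eps1 + b eps2.  In the *)
(* ambient R^2 one has eps1 = (1, 0) and eps2 = (1/2, 1/2).                   *)
Definition latP := 'cV[int]_2.
Definition eps1 : latP := delta_mx 0 0.
Definition eps2 : latP := delta_mx 1 0.
Definition Lam1 : latP := eps1.
Definition Lam2 : latP := eps2 *+ 2.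

Definition latQ : set latP :=
  [set lam | exists m n : int, lam = Lam1 *~ m + Lam2 *~ n].

Definition latQplus : set latP :=
  [set lam | exists m n : nat, lam = Lam1 *+ m + Lam2 *+ n].

(* The columns are the images of eps1 and eps2; since Lam2 = 2 eps2, this is  *)
(* s1 : Lam1 |-> Lam2 - Lam1, Lam2 |-> Lam2 and                               *)
(* s2 : Lam1 |-> Lam1, Lam2 |-> 2 Lam1 - Lam2.                                *)
Definition refl1 : 'M[int]_2 := row_mx (Lam2 - eps1) eps2.
Definition refl2 : 'M[int]_2 := row_mx eps1 (Lam1 - eps2).

Definition is_refl : {pred 'M[int]_2} := [in [:: refl1; refl2]].

(* The generators are involutions, so the products of generators form the     *)
(* subgroup that they generate.                                               *)
Definition weyl : set 'M[int]_2 :=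
  [set w | exists2 rs : seq 'M[int]_2, all is_refl rs & w = \prod_(r <- rs) r].

Lemma row_mx_eps (a b : latP) :
  (row_mx a b *m eps1 = a) * (row_mx a b *m eps2 = b).
Proof.
have e1 : eps1 = delta_mx (lshift 1 (ord0 : 'I_1)) 0 :> latP
    by congr delta_mx; apply: val_inj.
have e2 : eps2 = delta_mx (rshift 1 (ord0 : 'I_1)) 0 :> latP
    by congr delta_mx; apply: val_inj.
rewrite e1 e2 -!colE; split; apply/matrixP => i j; rewrite !ord1 !mxE.
  by rewrite (unsplitK (inl _)).
by rewrite (unsplitK (inr _)).
Qed.

Lemma row_eps1_eps2 : row_mx eps1 eps2 = 1 :> 'M[int]_2.
Proof.
apply/matrixP => i j; rewrite !mxE.
by case: splitP => k; rewrite ord1 mxE -val_eqE /= => jE;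
   rewrite -!val_eqE /= jE andbT.
Qed.

Lemma mulmx_cols (w : 'M[int]_2) (a b : latP) :
  w *m (row_mx a b : 'M_2) = row_mx (w *m a) (w *m b).
Proof. by rewrite -[LHS]/(w *m (row_mx a b : 'M_(2, 1 + 1))) mul_mx_row. Qed.

Lemma refl1K : refl1 * refl1 = 1.
Proof.
rewrite -mulmxE {2}/refl1 mulmx_cols /Lam2 mulmxBr mulr2n mulmxDr.
by rewrite !row_mx_eps /Lam2 mulr2n opprB addrC subrK row_eps1_eps2.
Qed.

Lemma refl2K : refl2 * refl2 = 1.
Proof.
rewrite -mulmxE {2}/refl2 mulmx_cols /Lam1 mulmxBr.
by rewrite !row_mx_eps /Lam1 opprB addrC subrK row_eps1_eps2.
Qed.

Lemma is_refl_invol r : is_refl r -> r * r = 1.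
Proof. by rewrite /is_refl !inE => /orP[] /eqP ->; [exact: refl1K | exact: refl2K]. Qed.

Lemma weyl_refl r : is_refl r -> r \in weyl.
Proof. by move=> hr; apply/mem_set; exists [:: r]; rewrite ?big_seq1 //= hr. Qed.

Lemma weyl1 : 1 \in weyl.
Proof. by apply/mem_set; exists [::]; rewrite ?big_nil. Qed.

Lemma weylM w x : w \in weyl -> x \in weyl -> w * x \in weyl.
Proof.
move=> /set_mem[rs hrs ->] /set_mem[qs hqs ->]; apply/mem_set.
by exists (rs ++ qs); rewrite ?big_cat // all_cat hrs.
Qed.

Lemma weyl_rev rs : all is_refl rs ->
  (\prod_(r <- rev rs) r) * (\prod_(r <- rs) r) = 1 :> 'M[int]_2.
Proof.
elim: rs => [|r rs IH] /=; first by rewrite !big_nil mulr1.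
case/andP=> hr /IH {}IH; rewrite rev_cons -cats1 big_cat big_seq1 big_cons /=.
by rewrite mulrA -(mulrA _ r r) is_refl_invol // mulr1.
Qed.

Lemma weylV_subproof w : w \in weyl ->
  (w \is a GRing.unit) /\ w^-1 \in weyl.
Proof.
move=> /set_mem[rs hrs ->].
have h1 := weyl_rev hrs.
have h2 : (\prod_(r <- rs) r) * (\prod_(r <- rev rs) r) = 1 :> 'M[int]_2.
  by have := @weyl_rev (rev rs); rewrite all_rev revK => /(_ hrs).
have hu : (\prod_(r <- rs) r : 'M[int]_2) \is a GRing.unit.
  by apply/unitrP; exists (\prod_(r <- rev rs) r).
split=> //; apply/mem_set; exists (rev rs); first by rewrite all_rev.
by apply: (mulIr hu); rewrite h1 mulVr.
Qed.

Lemma weyl_unit w : w \in weyl -> w \is a GRing.unit.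
Proof. by case/weylV_subproof. Qed.

Lemma weylV w : w \in weyl -> w^-1 \in weyl.
Proof. by case/weylV_subproof. Qed.

(* The extended affine Weyl group P >< W: the pair (lam, w) is t^lam w.       *)
Definition affW := {x : latP * 'M[int]_2 | x.2 \in weyl}.

HB.instance Definition _ := Choice.on affW.

Definition aff (lam : latP) (w : 'M[int]_2) (hw : w \in weyl) : affW :=
  exist _ (lam, w) hw.

Definition aff_one : affW := aff 0 weyl1.

Definition aff_mul (x y : affW) : affW :=
  aff ((val x).1 + (val x).2 *m (val y).1) (weylM (valP x) (valP y)).

Definition aff_inv (x : affW) : affW :=
  aff (- ((val x).2^-1 *m (val x).1)) (weylV (valP x)).

Lemma aff_mulA : associative aff_mul.
Proof.
move=> x y z; apply: val_inj; congr pair => /=; last by rewrite mulrA.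
by rewrite mulmxDr addrA mulmxA.
Qed.

Lemma aff_mul1 : left_id aff_one aff_mul.
Proof.
by move=> [[lam w] hw]; apply: val_inj; rewrite /= add0r mul1mx mul1r.
Qed.

Lemma aff_mulr1 : right_id aff_one aff_mul.
Proof.
by move=> [[lam w] hw]; apply: val_inj; rewrite /= mulmx0 addr0 mulr1.
Qed.

Lemma aff_mulV : left_inverse aff_one aff_inv aff_mul.
Proof.
move=> [[lam w] hw]; apply: val_inj; rewrite /= addrC subrr.
by rewrite mulVr ?weyl_unit.
Qed.

Lemma aff_mulrV : right_inverse aff_one aff_inv aff_mul.
Proof.
move=> [[lam w] hw]; apply: val_inj; rewrite /= mulmxN mulmxA mulmxE.
by rewrite divrr ?weyl_unit // mul1mx subrr.
Qed.

HB.instance Definition _ := isGroup.Build affW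
  aff_mulA aff_mul1 aff_mulr1 aff_mulV aff_mulrV.

Definition transl (lam : latP) : affW := aff lam weyl1.

Lemma refl1_is_refl : is_refl refl1. Proof. by rewrite /is_refl !inE eqxx. Qed.
Lemma refl2_is_refl : is_refl refl2. Proof. by rewrite /is_refl !inE eqxx orbT. Qed.

Definition s1 : affW := aff 0 (weyl_refl refl1_is_refl).
Definition s2 : affW := aff 0 (weyl_refl refl2_is_refl).
Definition s0 : affW := (transl Lam1 * s1 * s2 * s1)%g.
Definition tau : affW := (transl eps2 * s2 * s1 * s2)%g.

Definition simple_refls : seq affW := [:: s0; s1; s2].

Definition affWa : set affW := [set x | latQ (val x).1].

Definition word_lengths (x : affW) : set nat :=
  [set n | exists ws : seq affW,
    [/\ all [in simple_refls] ws, (\prod_(s <- ws) s)%g = x & size ws = n]].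

Definition coxeter_length (x : affW) : nat :=
  xget 0%N [set n | word_lengths x n /\
                    forall m, word_lengths x m -> (n <= m)%N].

(* Outside W_a, x = y tau with y = x tau^-1 in W_a. *)
Definition len (x : affW) : nat :=
  if x \in affWa then coxeter_length x else coxeter_length (x / tau)%g.

Definition conj_class (x : affW) : set affW := [set (x ^ y)%g | y in setT].
Definition conj_classes : set (set affW) := [set conj_class x | x in setT].

Definition min_len (O : set affW) (x : affW) : Prop :=
  O x /\ forall y, O y -> (len x <= len y)%N.

Definition transl_orbit (lam : latP) : set affW :=
  [set transl (w *m lam) | w in weyl].

(* A = Z[v, v^-1], as the subring of the fractions p / v^n in Q(v). *)
Definition fracv : {fraction {poly int}} := tofrac 'X.

Definition laurent_pred : {pred {fraction {poly int}}} :=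
  [in [set q | exists (p : {poly int}) (n : nat), q = tofrac p / fracv ^+ n]].

Lemma fracv_unit : fracv \is a GRing.unit.
Proof. by rewrite unitfE tofrac_eq0 polyX_eq0. Qed.

Lemma laurent_subring : subring_closed laurent_pred.
Proof.
have u n : fracv ^+ n \is a GRing.unit by rewrite unitrX ?fracv_unit.
split.
- by apply/mem_set; exists 1, 0%N; rewrite tofrac1 expr0 divr1.
- move=> _ _ /set_mem[p [n ->]] /set_mem[q [m ->]]; apply/mem_set.
  exists (p * 'X^m - q * 'X^n), (n + m)%N.
  rewrite tofracB !tofracM !tofracXn -/fracv mulrBl exprD invrM // !mulrA.
  congr (_ - _); first by rewrite mulrK.
  by rewrite -!mulrA [in RHS](mulrCA _ (_ ^- m)) mulrV // mulr1.
- move=> _ _ /set_mem[p [n ->]] /set_mem[q [m ->]]; apply/mem_set.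
  exists (p * q), (n + m)%N.
  by rewrite tofracM exprD invrM // mulrACA [in RHS](mulrC (_ ^- m)).
Qed.

HB.instance Definition _ :=
  GRing.isSubringClosed.Build _ laurent_pred laurent_subring.

Definition laurent := {q : {fraction {poly int}} | q \in laurent_pred}.

HB.instance Definition _ := SubChoice.on laurent.
HB.instance Definition _ := [SubChoice_isSubComNzRing of laurent by <:].

Lemma laurent_v_subproof : fracv \in laurent_pred.
Proof. by apply/mem_set; exists 'X, 0%N; rewrite expr0 divr1. Qed.

Lemma laurent_vinv_subproof : fracv^-1 \in laurent_pred.
Proof. by apply/mem_set; exists 1, 1%N; rewrite expr1 tofrac1 mul1r. Qed.

Definition lv : laurent := exist _ fracv laurent_v_subproof.
Definition lvinv : laurent := exist _ fracv^-1 laurent_vinv_subproof.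

(* The degree of f in v - v^-1, with deg 0 = -oo. The default value +oo is    *)
(* taken exactly when f is not a polynomial in v - v^-1.                      *)
Definition poly_deg (p : {poly int}) : \bar int :=
  if p == 0 then -oo%E else ((size p).-1%:Z)%:E.

Definition vdeg (f : laurent) : \bar int :=
  xget +oo%E [set poly_deg p | p in
    [set p : {poly int} | f = (map_poly intr p).[lv - lvinv]]].

Definition is_basis (H : algType laurent) (T : affW -> H) : Prop :=
  (forall h : H, exists (xs : seq affW) (a : affW -> laurent),
     h = \sum_(x <- xs) a x *: T x) /\
  (forall (xs : seq affW) (a : affW -> laurent), uniq xs ->
     \sum_(x <- xs) a x *: T x = 0 -> {in xs, forall x, a x = 0}).

Record is_hecke_algebra (H : algType laurent) (T : affW -> H) : Prop := IsHeckeAlgebra {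
  hecke_basis : is_basis T;
  hecke_mul : forall x y : affW,
    (len x + len y)%N = len (x * y)%g -> T x * T y = T (x * y)%g;
  hecke_quad : {in simple_refls, forall s,
    (T s - lv *: 1) * (T s + lvinv *: 1) = 0}
}.

Definition comm_submod (H : algType laurent) : set H :=
  [set h | exists ts : seq (laurent * (H * H)),
     h = \sum_(t <- ts) t.1 *: (t.2.1 * t.2.2 - t.2.2 * t.2.1)].

(* For a system rep of minimal length representatives of the conjugacy        *)
(* classes, f gives the coordinates of the image of T w with respect to the   *)
(* family of images of the T (rep O).                                         *)
Definition cocenter_coords (H : algType laurent) (T : affW -> H)
    (rep : set affW -> affW) (w : affW) (f : set affW -> laurent) : Prop :=
  [/\ forall O, ~ conj_classes O -> f O = 0,
      finite_set [set O | f O != 0] &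
      comm_submod (T w - \sum_(O \in conj_classes) f O *: T (rep O))].

Definition class_poly (H : algType laurent) (T : affW -> H)
    (rep : set affW -> affW) (w : affW) : set affW -> laurent :=
  xget (fun=> 0) (cocenter_coords T rep w).

(* Main.v *)
Require Import Defs.
From HB Require Import structures.
From mathcomp Require Import all_boot all_order all_algebra.
From mathcomp Require Import monoid.
From mathcomp Require Import all_classical.
From mathcomp Require Import constructive_ereal.
From mathcomp Require Import zify ring.
Set Implicit Arguments.
Unset Strict Implicit.
Unset Printing Implicit Defensive.
Import Order.TTheory GRing.Theory Num.Theory.
Local Open Scope classical_set_scope.
Local Open Scope ring_scope.

(**
Two facts are needed. The first is that T_w and T_x have the same image in the
cocenter when w and x are translations by weights in one Weyl group orbit. For
a simple reflection s of W the translations t^mu and s t^mu s have the same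
length; if s t^mu is shorter than t^mu, then T_{t^mu} = T_s T_h and
T_{s t^mu s} = T_h T_s with h = s t^mu, so the two differ by a commutator
([comm_transl]). Hence T_w is congruent to the image of O_lambda, with
coefficient 1.

The second fact is that these coordinates are unique, that is, that the images
of the minimal length representatives are linearly independent over
Z[v, v^-1] ([cocenter_free]). A linear relation is killed by every trace
function of the Hecke algebra. If sufficiently many trace functions, at v = 1,
separate the conjugacy classes of the group, then all coefficients of the
relation vanish at v = 1; dividing by v - 1 and repeating shows that they
vanish ([lifting_independence]).

The trace functions come from representations on functions on affine
functionals of the weight lattice. A generator T_s acts as the reflection s
plus (v - 1/v) times the indicator of one side of the wall, the sides being
oriented by the linear part of the functional; when s fixes the functional, T_s
is the scalar v or -1/v. The braid relations are a check on the sectors of the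
plane ([refl_op_braid]), and Matsumoto's theorem extends the operators to the
whole group ([matsumoto], [word_rep]); it needs the length function, which
counts hyperplanes ([lenE]). Constant terms are taken modulo N, so the Weyl
group orbits are finite and traces exist; following the operator by a shift of
the constant term gives further trace functions.

At v = 1 and with the scalar v, the group permutes the functionals, and such a
trace counts the functionals in an orbit to which a group element adds a given
constant ([twisted_trace_classical]). A regular orbit separates the translations;
the two orbits of singular directions separate the elements whose linear part
is a reflection; on the zero functional the scalars v and -1/v separate the five
remaining classes ([separate_transl], [separate_refl1], [separate_refl2],
[vanishing_elliptic]).

Finally, the degree is well defined because v - 1/v is transcendental over Z
([lxi_transcendental]).
*)

(** * Coordinates on the extended affine Weyl group *)

Definition vec2 (a b : int) : latP := \col_(i < 2) (if i == 0 then a else b).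
Definition mat2 (a b c d : int) : 'M[int]_2 :=
  \matrix_(i < 2, j < 2)
    (if i == 0 then if j == 0 then a else b else if j == 0 then c else d).

Lemma ord2P (P : 'I_2 -> Prop) : P 0 -> P 1 -> forall i, P i.
Proof.
move=> P0 P1 [[|[|//]] hi].
  by rewrite (_ : Ordinal hi = 0) //; apply: val_inj.
by rewrite (_ : Ordinal hi = 1) //; apply: val_inj.
Qed.

Lemma sum2 (F : 'I_2 -> int) : \sum_(i < 2) F i = F 0 + F 1.
Proof.
rewrite big_ord_recl big_ord1; congr (_ + F _); exact: val_inj.
Qed.

Lemma vec2E a b : (vec2 a b 0 0 = a) * (vec2 a b 1 0 = b).
Proof. by rewrite !mxE. Qed.

Lemma mat2E a b c d :
  ((mat2 a b c d 0 0 = a) * (mat2 a b c d 0 1 = b)) *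
  ((mat2 a b c d 1 0 = c) * (mat2 a b c d 1 1 = d)).
Proof. by rewrite !mxE. Qed.

Lemma vec2_eta (l : latP) : l = vec2 (l 0 0) (l 1 0).
Proof.
by apply/matrixP; apply: ord2P => j; rewrite ord1 !mxE.
Qed.

Lemma mat2_eta (u : 'M[int]_2) : u = mat2 (u 0 0) (u 0 1) (u 1 0) (u 1 1).
Proof.
by apply/matrixP; apply: ord2P; apply: ord2P; rewrite !mxE.
Qed.

Lemma mat2_vec2 a b c d x y :
  mat2 a b c d *m vec2 x y = vec2 (a * x + b * y) (c * x + d * y).
Proof.
by rewrite [LHS]vec2_eta !mxE !sum2 !mat2E !vec2E.
Qed.

Lemma mat2M a b c d a' b' c' d' :
  mat2 a b c d * mat2 a' b' c' d' =
  mat2 (a * a' + b * c') (a * b' + b * d') (c * a' + d * c') (c * b' + d * d').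
Proof.
by rewrite -mulmxE [LHS]mat2_eta !mxE !sum2 !mat2E.
Qed.

Lemma vec2D x y x' y' : vec2 x y + vec2 x' y' = vec2 (x + x') (y + y').
Proof. by rewrite [LHS]vec2_eta !mxE !eqxx. Qed.

Lemma mat2_1 : 1 = mat2 1 0 0 1.
Proof. by rewrite [LHS]mat2_eta !mxE. Qed.

Lemma eps1E : eps1 = vec2 1 0.
Proof. by rewrite [LHS]vec2_eta !mxE. Qed.

Lemma eps2E : eps2 = vec2 0 1.
Proof. by rewrite [LHS]vec2_eta !mxE. Qed.

Lemma vec2_0 : 0 = vec2 0 0.
Proof. by rewrite [LHS]vec2_eta !mxE. Qed.

Lemma row_mx_vec2 a b c d :
  row_mx (vec2 a b) (vec2 c d) = mat2 a c b d :> 'M[int]_2.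
Proof.
apply/matrixP => i j; rewrite mxE; case: splitP => k; rewrite ord1 /= => jE.
  by rewrite (_ : j = 0) ?mxE //; apply: val_inj.
by rewrite (_ : j = 1) ?mxE //; apply: val_inj.
Qed.

Lemma refl1E : refl1 = mat2 (-1) 0 2 1.
Proof.
rewrite /refl1 /Lam2 eps1E eps2E mulr2n vec2D.
rewrite (_ : - vec2 1 0 = vec2 (-1) 0); last by rewrite [LHS]vec2_eta !mxE.
by rewrite vec2D row_mx_vec2.
Qed.

Lemma refl2E : refl2 = mat2 1 1 0 (-1).
Proof.
rewrite /refl2 /Lam1 eps1E eps2E.
rewrite (_ : - vec2 0 1 = vec2 0 (-1)); last by rewrite [LHS]vec2_eta !mxE.
by rewrite vec2D row_mx_vec2.
Qed.

Lemma val_mul (x y : affW) :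
  val (x * y)%g = ((val x).1 + (val x).2 *m (val y).1, (val x).2 * (val y).2).
Proof. by []. Qed.

Definition affE := (val_mul, mat2_vec2, mat2M, vec2D).

Lemma val_s1 : val s1 = (vec2 0 0, mat2 (-1) 0 2 1).
Proof. by rewrite /= refl1E -vec2_0. Qed.

Lemma val_s2 : val s2 = (vec2 0 0, mat2 1 1 0 (-1)).
Proof. by rewrite /= refl2E -vec2_0. Qed.

Lemma val_transl l : val (transl l) = (l, 1).
Proof. by []. Qed.

Lemma val_s0 : val s0 = (vec2 1 0, mat2 (-1) (-1) 0 1).
Proof.
rewrite /s0 !val_mul val_transl val_s1 val_s2 /= /Lam1 eps1E mat2_1.
by rewrite !affE.
Qed.

Lemma val_tau : val tau = (vec2 0 1, mat2 1 0 (-2) (-1)).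
Proof.
rewrite /tau !val_mul val_transl val_s1 val_s2 /= eps2E mat2_1.
by rewrite !affE.
Qed.

Lemma val_one : val (1%g : affW) = (vec2 0 0, mat2 1 0 0 1).
Proof. by rewrite /= -mat2_1 -vec2_0. Qed.

Inductive gen := G0 | G1 | G2.

(** The simple reflections and [omega] are sealed, because [s0] and [tau] are
    themselves products and would be unfolded when a product is looked for. *)
Definition srefl (i : gen) : affW :=
  locked match i with G0 => s0 | G1 => s1 | G2 => s2 end.
Definition omega : affW := locked tau.

Lemma val_srefl i : val (srefl i) = match i with
  | G0 => (vec2 1 0, mat2 (-1) (-1) 0 1)
  | G1 => (vec2 0 0, mat2 (-1) 0 2 1)
  | G2 => (vec2 0 0, mat2 1 1 0 (-1))
  end.
Proof. by rewrite /srefl -lock; case: i; rewrite ?val_s0 ?val_s1 ?val_s2. Qed.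

Lemma val_omega : val omega = (vec2 0 1, mat2 1 0 (-2) (-1)).
Proof. by rewrite /omega -lock val_tau. Qed.

Lemma sreflK i x : (srefl i * (srefl i * x))%g = x.
Proof.
rewrite mulgA (_ : (srefl i * srefl i)%g = 1%g) ?mul1g //.
by apply: val_inj; rewrite val_one val_mul val_srefl; case: i; rewrite /= !affE.
Qed.

Lemma omega2 : (omega * omega)%g = 1%g.
Proof. by apply: val_inj; rewrite val_one val_mul val_omega /= !affE. Qed.

Definition weyl_list : seq 'M[int]_2 :=
  [:: mat2 1 0 0 1; mat2 (-1) 0 2 1; mat2 1 1 0 (-1); mat2 (-1) (-1) 2 1;
      mat2 1 1 (-2) (-1); mat2 (-1) (-1) 0 1; mat2 1 0 (-2) (-1);
      mat2 (-1) 0 0 (-1)].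

Lemma weyl_list_closed r u : is_refl r -> u \in weyl_list -> r * u \in weyl_list.
Proof.
rewrite /is_refl inE refl1E refl2E !inE => /orP[] /eqP-> H;
  repeat (case/orP: H => [/eqP->|H]); try (move/eqP: H => ->);
  rewrite mat2M; rewrite ?eqxx ?orbT //.
Qed.

Lemma weyl_enum u : u \in weyl -> u \in weyl_list.
Proof.
move/set_mem => [rs hrs ->]; elim: rs hrs => [_|r rs IH /= /andP[hr /IH h]].
  by rewrite big_nil !inE mat2_1 eqxx.
by rewrite big_cons; apply: weyl_list_closed.
Qed.

(** The group acts on the weight space; [base_a x] and [base_b x] are the values
    of alpha_1 and alpha_2 at the image under [x] of an interior point of the
    fundamental alcove, in units of 1/4. The base point has values (1, 1): it is
    off every wall and fixed by [tau], so these two integers control the length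
    on both cosets of W_a. *)
Definition base_a (x : affW) : int :=
  (val x).1 0 0 * 4 + (val x).2 0 0 + (val x).2 0 1.
Definition base_b (x : affW) : int :=
  (val x).1 1 0 * 4 + (val x).2 1 0 + (val x).2 1 1.

Lemma base_mul x y :
  (base_a (x * y)%g = (val x).1 0 0 * 4 + (val x).2 0 0 * base_a y + (val x).2 0 1 *
      base_b y) *
  (base_b (x * y)%g = (val x).1 1 0 * 4 + (val x).2 1 0 * base_a y + (val x).2 1 1 *
      base_b y).
Proof.
rewrite /base_a /base_b val_mul /= -mulmxE !mxE !sum2.
split; ring.
Qed.

Lemma base_srefl1 x : (base_a (srefl G1 * x)%g = - base_a x) *
    (base_b (srefl G1 * x)%g = 2 * base_a x + base_b x).
Proof. rewrite !base_mul val_srefl /= !vec2E !mat2E; split; ring. Qed.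

Lemma base_srefl2 x : (base_a (srefl G2 * x)%g = base_a x + base_b x) *
    (base_b (srefl G2 * x)%g = - base_b x).
Proof. rewrite !base_mul val_srefl /= !vec2E !mat2E; split; ring. Qed.

Lemma base_srefl0 x : (base_a (srefl G0 * x)%g = 4 - base_a x - base_b x) *
    (base_b (srefl G0 * x)%g = base_b x).
Proof. rewrite !base_mul val_srefl /= !vec2E !mat2E; split; ring. Qed.

Lemma base_omega x : (base_a (omega * x)%g = base_a x) *
    (base_b (omega * x)%g = 4 - 2 * base_a x - base_b x).
Proof. rewrite !base_mul val_omega /= !vec2E !mat2E; split; ring. Qed.

Lemma base_one : (base_a 1%g = 1) * (base_b 1%g = 1).
Proof. by rewrite /base_a /base_b val_one /= !vec2E !mat2E. Qed.

Lemma base_mul_omega x : (base_a (x * omega)%g = base_a x) *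
    (base_b (x * omega)%g = base_b x).
Proof.
have hA : base_a omega = 1 by rewrite /base_a val_omega /= !vec2E !mat2E.
have hB : base_b omega = 1 by rewrite /base_b val_omega /= !vec2E !mat2E.
by rewrite !(base_mul x omega) hA hB /base_a /base_b; split; ring.
Qed.

(** The integers that separate a value in (0, 1), where the base alcove lies, from t/4
    are those from 1 to t/4 for t > 0, and those from t/4 to 0 for t < 0. *)
Definition walls_below (t : int) : nat := absz (t %/ 4)%Z.

(** The number of reflection hyperplanes that separate the base alcove from its
    image, one summand for each of the four positive roots. *)
Definition alen (x : affW) : nat :=
  (walls_below (base_a x) + walls_below (base_b x) + walls_below
      (base_a x + base_b x) + walls_below (2 * base_a x + base_b x))%N.

(** Induction over the eight possible linear parts: it turns a statement about an
    affine Weyl group element into eight linear arithmetic statements. *)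
Lemma linear_part_ind (P : 'M[int]_2 -> Prop) :
  P (mat2 1 0 0 1) -> P (mat2 (-1) 0 2 1) -> P (mat2 1 1 0 (-1)) ->
  P (mat2 (-1) (-1) 2 1) -> P (mat2 1 1 (-2) (-1)) -> P (mat2 (-1) (-1) 0 1) ->
  P (mat2 1 0 (-2) (-1)) -> P (mat2 (-1) 0 0 (-1)) ->
  forall x : affW, P (val x).2.
Proof.
move=> h1 h2 h3 h4 h5 h6 h7 h8 x; have := weyl_enum (valP x).
by rewrite !inE => H; repeat (case/orP: H => [/eqP->//|H]); move/eqP: H => ->.
Qed.

Lemma base_regular x :
  [&& (base_a x %% 4)%Z != 0, (base_b x %% 4)%Z != 0,
      ((base_a x + base_b x) %% 4)%Z != 0 &
      ((2 * base_a x + base_b x) %% 4)%Z != 0].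
Proof.
rewrite /base_a /base_b; move: ((val x).1 0 0) ((val x).1 1 0) => a b.
pattern (val x).2; apply: linear_part_ind; rewrite !mat2E; lia.
Qed.

Definition descent (i : gen) (x : affW) : bool :=
  match i with
  | G0 => 4 < 2 * base_a x + base_b x | G1 => base_a x < 0 | G2 => base_b x < 0
  end.

(** Reflecting in the wall t = 0 crosses exactly that wall. *)
Lemma walls_below_opp t : (t %% 4)%Z != 0 ->
  if t < 0 then walls_below t = (walls_below (- t)).+1 else walls_below (- t) =
      (walls_below t).+1.
Proof. by rewrite /walls_below; case: ifP; lia. Qed.

Lemma walls_below_refl4 t : (t %% 4)%Z != 0 -> walls_below (4 - t) = walls_below t.
Proof. by rewrite /walls_below; lia. Qed.

(** Reflecting in the wall t = 4 crosses exactly that wall. *)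
Lemma walls_below_refl8 t : (t %% 4)%Z != 0 ->
  if 4 < t then walls_below t = (walls_below (8 - t)).+1 else walls_below (8 - t) =
      (walls_below t).+1.
Proof. by rewrite /walls_below; case: ifP; lia. Qed.

(** A simple reflection permutes the hyperplanes, except that its own wall is
    gained or lost; the side of that wall on which the alcove lies decides. *)
Lemma alen_srefl i x : if descent i x then alen x = (alen (srefl i * x)%g).+1
                 else alen (srefl i * x)%g = (alen x).+1.
Proof.
have /and4P[hA hB hAB hAAB] := base_regular x.
rewrite /descent /alen; case: i.
- rewrite !base_srefl0.
  have -> : 2 * (4 - base_a x - base_b x) + base_b x =
      8 - (2 * base_a x + base_b x) by ring.
  have -> : 4 - base_a x - base_b x + base_b x = 4 - base_a x by ring.
  have -> : 4 - base_a x - base_b x = 4 - (base_a x + base_b x) by ring.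
  rewrite !walls_below_refl4 //; have := walls_below_refl8 hAAB.
  by case: ifP => _ ->; lia.
- rewrite !base_srefl1.
  have -> : - base_a x + (2 * base_a x + base_b x) = base_a x + base_b x by ring.
  have -> : 2 * - base_a x + (2 * base_a x + base_b x) = base_b x by ring.
  by have := walls_below_opp hA; case: ifP => _ ->; lia.
- rewrite !base_srefl2.
  have -> : base_a x + base_b x + - base_b x = base_a x by ring.
  have -> : 2 * (base_a x + base_b x) + - base_b x = 2 * base_a x + base_b x by ring.
  by have := walls_below_opp hB; case: ifP => _ ->; lia.
Qed.

Lemma alen_omega x : alen (omega * x)%g = alen x.
Proof.
have /and4P[hA hB hAB hAAB] := base_regular x.
rewrite /alen !base_omega.
have -> : base_a x + (4 - 2 * base_a x - base_b x) = 4 - (base_a x + base_b x) by ring.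
have -> : 2 * base_a x + (4 - 2 * base_a x - base_b x) = 4 - base_b x by ring.
have -> : 4 - 2 * base_a x - base_b x = 4 - (2 * base_a x + base_b x) by ring.
by rewrite !walls_below_refl4 //; lia.
Qed.

Lemma alen_mul_omega x : alen (x * omega)%g = alen x.
Proof. by rewrite /alen !base_mul_omega. Qed.

Lemma alen_one : alen 1%g = 0%N.
Proof. by rewrite /alen !base_one. Qed.

(** An alcove on the inner side of the three simple walls is the base alcove, whose
    stabilizer is {1, tau}. *)
Lemma descent_exists x : [\/ exists i, descent i x, x = 1%g | x = omega].
Proof.
have := base_regular x.
case d0: (descent G0 x); first by constructor; exists G0.
case d1: (descent G1 x); first by constructor; exists G1.
case d2: (descent G2 x); first by constructor; exists G2.
move: d0 d1 d2; rewrite /= => d0 d1 d2 reg.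
have [eA eB] : base_a x = 1 /\ base_b x = 1 by lia.
suff : val x = val (1%g : affW) \/ val x = val omega.
  by case=> /val_inj ->; [constructor 2 | constructor 3].
move: eA eB; rewrite val_one val_omega /base_a /base_b [val x]surjective_pairing.
move: (val x).1 (vec2_eta (val x).1) => l el eA eB; rewrite {}el; move: eA eB.
move: (l 0 0) (l 1 0) => a b.
pattern (val x).2; apply: linear_part_ind; rewrite !mat2E => eA eB;
  try (exfalso; lia); [left | right].
  by have [-> ->] : a = 0 /\ b = 0 by lia.
by have [-> ->] : a = 0 /\ b = 1 by lia.
Qed.

(** * Words, parity and the Coxeter length *)

Fixpoint word_elt (ws : seq gen) : affW :=
  if ws is i :: ws' then (srefl i * word_elt ws')%g else 1%g.

Definition omega_pow (e : bool) : affW := if e then omega else 1%g.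

Lemma word_elt_cat a b : word_elt (a ++ b) = (word_elt a * word_elt b)%g.
Proof. by elim: a => [|i a IH] /=; rewrite ?mul1g // IH mulgA. Qed.

Lemma alen_mul_omega_pow x e : alen (x * omega_pow e)%g = alen x.
Proof. by case: e; rewrite /= ?alen_mul_omega ?mulg1. Qed.

Lemma alen_word ws : (alen (word_elt ws) <= size ws)%N.
Proof.
elim: ws => [|i ws IH] /=; first by rewrite alen_one.
by have := alen_srefl i (word_elt ws); case: ifP => _; lia.
Qed.

Lemma descentE i x : descent i x = (alen (srefl i * x)%g < alen x)%N.
Proof. by have := alen_srefl i x; case: ifP => _ ->;
    rewrite ?ltnSn // ltnNge leqnSn. Qed.

Lemma reduced_exists x :
  exists ws e, x = (word_elt ws * omega_pow e)%g /\ size ws = alen x.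
Proof.
have [n] := ubnP (alen x); elim: n x => // n IH x hn.
case: (descent_exists x) => [[i di]|->|->].
- have := alen_srefl i x; rewrite di => Lx.
  have [|ws [e [e1 e2]]] := IH (srefl i * x)%g; first by lia.
  exists (i :: ws), e; split; last by rewrite /= e2 Lx.
  by rewrite /= -mulgA -e1 sreflK.
- by exists [::], false; rewrite /= mulg1 alen_one.
- by exists [::], true; rewrite /= mul1g -[omega]mulg1 alen_omega alen_one.
Qed.

(** Induction on the length, written so that only products that increase the length
    have to be treated. *)
Lemma affW_ind (P : affW -> Prop) : P 1%g ->
  (forall x, P x -> P (omega * x)%g) ->
  (forall i x, P x -> alen (srefl i * x)%g = (alen x).+1 -> P (srefl i * x)%g) ->
  forall x, P x.
Proof.
move=> P1 Pt Ps x; have [n] := ubnP (alen x); elim: n x => // n IH x hn.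
case: (descent_exists x) => [[i di]|->|->] //; last by rewrite -[omega]mulg1; apply: Pt.
have := alen_srefl i x; rewrite di => Lx.
rewrite -(sreflK i x); apply: Ps; last by rewrite sreflK Lx.
by apply: IH; lia.
Qed.

(** The homomorphism with kernel W_a: the coefficient of eps2 modulo 2 is unchanged by
    the Weyl group. *)
Definition parity (x : affW) : bool := modz ((val x).1 1 0) 2 == 1.

Lemma parity_mul x y : parity (x * y)%g = parity x (+) parity y.
Proof.
rewrite /parity val_mul [_.1]/= !mxE sum2.
move: ((val x).1 1 0) ((val y).1 0 0) ((val y).1 1 0) => a b c.
by pattern (sval x).2; apply: linear_part_ind; rewrite !mat2E; lia.
Qed.

Lemma parity_one : parity 1%g = false.
Proof. by rewrite /parity val_one /= vec2E. Qed.

Lemma parity_omega : parity omega = true.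
Proof. by rewrite /parity val_omega /= vec2E. Qed.

Lemma parity_srefl i : parity (srefl i) = false.
Proof. by rewrite /parity val_srefl; case: i; rewrite /= vec2E. Qed.

Lemma parity_word ws : parity (word_elt ws) = false.
Proof. by elim: ws => [|i ws IH] /=; rewrite ?parity_one // parity_mul parity_srefl
    IH. Qed.

Lemma parity_omega_pow e : parity (omega_pow e) = e.
Proof. by case: e; rewrite ?parity_omega ?parity_one. Qed.

Lemma vec2Mz a b n : vec2 a b *~ n = vec2 (a * n) (b * n).
Proof.
by rewrite -scaler_int [LHS]vec2_eta !mxE !intz !(mulrC n).
Qed.

Lemma affWa_parity x : (x \in affWa) = ~~ parity x.
Proof.
rewrite /parity; apply/idP/idP => [/set_mem [m [n ->]]|h].
  rewrite /Lam1 /Lam2 eps1E eps2E mulr2n vec2D !vec2Mz vec2D vec2E.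
  by lia.
apply/mem_set; exists ((val x).1 0 0), (divz ((val x).1 1 0) 2).
rewrite /Lam1 /Lam2 eps1E eps2E mulr2n vec2D !vec2Mz vec2D.
by rewrite [LHS]vec2_eta; congr vec2; lia.
Qed.

Lemma word_gens ws : all [in simple_refls] ws -> exists gs, ws = map srefl gs.
Proof.
elim: ws => [|x ws IH] /=; first by exists [::].
case/andP=> hx /IH [gs ->].
have [i ->] : exists i, x = srefl i.
  by move: hx; rewrite /srefl !inE => /or3P[] /eqP ->;
      [exists G0 | exists G1 | exists G2]; rewrite -lock.
by exists (i :: gs).
Qed.

Lemma word_eltE gs : (\prod_(s <- map srefl gs) s)%g = word_elt gs.
Proof. by elim: gs => [|i gs IH]; rewrite ?big_nil // big_cons IH. Qed.

Lemma srefl_simple i : srefl i \in simple_refls.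
Proof.
have mem3 (T : eqType) (a b c : T) : [/\ a \in [:: a; b; c], b \in [:: a; b; c] &
    c \in [:: a; b; c]] by split; rewrite !inE eqxx ?orbT.
case: (mem3 _ s0 s1 s2) => h0 h1 h2.
by rewrite /srefl -lock; case: i; [exact: h0 | exact: h1 | exact: h2].
Qed.

Lemma word_lengths_elt gs : word_lengths (word_elt gs) (size gs).
Proof.
exists (map srefl gs); split; rewrite ?size_map ?word_eltE //.
elim: gs => [//|i gs IH]; rewrite map_cons; apply/andP; split; last exact: IH.
exact: srefl_simple.
Qed.

Lemma coxeter_lengthE x : ~~ parity x -> coxeter_length x = alen x.
Proof.
move=> px.
have [ws [e [ex es]]] := reduced_exists x.
have e0 : e = false.
  by move: px; rewrite ex parity_mul parity_word parity_omega_pow; case: e {ex}.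
have {}ex : x = word_elt ws by rewrite ex e0 /= mulg1.
have lb m : word_lengths x m -> (alen x <= m)%N.
  by move=> [qs [/word_gens [gs ->] <- <-]]; rewrite size_map word_eltE alen_word.
have hL : word_lengths x (alen x) by rewrite -es {1}ex; apply: word_lengths_elt.
apply: xget_unique => // m [hm hmin].
by apply/eqP; rewrite eqn_leq lb // hmin.
Qed.

(** A word is at least as long as the number of walls it crosses, and following
    descents produces a word that crosses one new wall at each step. *)
Lemma lenE x : len x = alen x.
Proof.
rewrite /len affWa_parity; case: ifPn => [|/negPn] px; first exact: coxeter_lengthE.
have -> : (x / tau)%g = (x * omega)%g.
  by congr (x * _)%g; apply: (mulgI tau); have := omega2;
      rewrite mulgV /omega -lock => ->.
by rewrite coxeter_lengthE ?alen_mul_omega // parity_mul px parity_omega.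
Qed.

Definition braid_word (i j : gen) : seq gen :=
  match i, j with
  | G0, G2 => [:: G0; G2]
  | G2, G0 => [:: G2; G0]
  | i, j => [:: i; j; i; j]
  end.

(** * Reduced words and braid moves *)

Lemma word_elt_braid i j : word_elt (braid_word i j) = word_elt (braid_word j i).
Proof.
by case: i; case: j => //; rewrite /= !mulg1; apply: val_inj;
  rewrite !val_mul !val_srefl [_.1]/= [_.2]/= !affE.
Qed.

Lemma word_elt_braidK i j x : (word_elt (braid_word i j) *
    (word_elt (braid_word j i) * x))%g = x.
Proof.
by case: i; case: j; rewrite /= !mulg1 -!mulgA !sreflK.
Qed.

(** The rank two case of the exchange property: an element with two left descents
    starts with the longest element of the dihedral group that they generate. *)
Lemma alen_braid i j x : i <> j -> descent i x -> descent j x ->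
  alen x = (size (braid_word i j) + alen (word_elt (braid_word i j) * x)%g)%N.
Proof.
have step k y : descent k y -> alen y = (alen (srefl k * y)%g).+1.
  by have := alen_srefl k y => /[swap] ->.
have d0 y : descent G0 y = (4 < 2 * base_a y + base_b y) by [].
have d1 y : descent G1 y = (base_a y < 0) by [].
have d2 y : descent G2 y = (base_b y < 0) by [].
have ch2 a b y : descent a y -> descent b (srefl a * y)%g -> alen y =
    (2 + alen (srefl b * (srefl a * y)))%g.
  by move=> /step -> /step ->.
have ch4 a b y : descent a y -> descent b (srefl a * y)%g ->
    descent a (srefl b * (srefl a * y))%g ->
    descent b (srefl a * (srefl b * (srefl a * y)))%g ->
    alen y = (4 + alen (srefl b * (srefl a * (srefl b * (srefl a * y)))))%g.
  by move=> /step -> /step -> /step -> /step ->.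
have q := (d0, d1, d2, base_srefl0, base_srefl1, base_srefl2).
case: i; case: j => // _ di dj; cbn [braid_word word_elt size]; rewrite !mulg1 -!mulgA;
  move: di dj; rewrite ?q => di dj.
all: first [apply: ch4 | apply: ch2]; rewrite ?q; lia.
Qed.

Lemma gen_eq_dec (i j : gen) : i = j \/ i <> j.
Proof. by case: i; case: j; (left; reflexivity) || (right; discriminate). Qed.

Section Matsumoto.
Variables (Y : Type) (t : gen -> Y -> Y).

Fixpoint word_op (ws : seq gen) (y : Y) : Y :=
  if ws is i :: ws' then t i (word_op ws' y) else y.

Lemma word_op_cat a b y : word_op (a ++ b) y = word_op a (word_op b y).
Proof. by elim: a => //= i a ->. Qed.

Hypothesis braid : forall i j y, word_op (braid_word i j) y =
    word_op (braid_word j i) y.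

Lemma braid_word_head i j : i <> j -> exists r, braid_word i j = i :: r.
Proof. by case: i; case: j => // _; eexists. Qed.

Lemma reduced_even x : ~~ parity x -> exists2 ws, x = word_elt ws & size ws = alen x.
Proof.
move=> px; have [ws [e [ex es]]] := reduced_exists x; exists ws => //.
move: px; rewrite ex parity_mul parity_word parity_omega_pow.
by case: e {ex}; rewrite //= mulg1.
Qed.

(** Matsumoto's theorem. If two reduced words for the same element start with
    different letters, both are compared by induction with reduced words that
    start with the two sides of the braid relation and agree afterwards. *)
Lemma matsumoto ws ws' y :
  word_elt ws = word_elt ws' -> size ws = alen (word_elt ws) -> size ws' =
      alen (word_elt ws) ->
  word_op ws y = word_op ws' y.
Proof.
have [n] := ubnP (size ws); elim: n ws ws' => // n IH [|i a] [|j b] hn; rewrite //.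
- by rewrite /= alen_one.
- by move=> -> /=; rewrite alen_one.
set x := word_elt (i :: a) => ex ea eb.
have tl k c : word_elt (k :: c) = x -> size (k :: c) = alen x ->
    [/\ descent k x, word_elt c = (srefl k * x)%g & size c = alen (word_elt c)].
  move=> /= e1 e2; have e3 : word_elt c = (srefl k * x)%g by rewrite -e1 sreflK.
  have dk : descent k x by rewrite descentE -e3 -e2 ltnS alen_word.
  by have := alen_srefl k x; rewrite dk -e3 -e2 => -[].
have key k c c' : word_elt (k :: c) = x -> word_elt (k :: c') = x ->
    size (k :: c) = alen x -> size (k :: c') = alen x ->
    word_op (k :: c) y = word_op (k :: c') y.
  move=> e1 e2 e3 e4 /=; congr t.
  have [_ p1 l1] := tl _ _ e1 e3; have [_ p2 l2] := tl _ _ e2 e4.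
  apply: IH; rewrite ?p1 ?p2 -?p1 // ?l2 ?p1 ?p2 //.
  by move: e3 ea hn; rewrite /= => -> <-.
case: (gen_eq_dec i j) => [eij|nij].
  by subst j; apply: key; [| exact: esym | |].
have [di _ _] := tl _ _ (erefl _) ea; have [dj _ _] := tl _ _ (esym ex) eb.
have ji : j <> i by move/esym.
have px : ~~ parity (word_elt (braid_word i j) * x)%g by rewrite parity_mul
    !parity_word.
have [u eu su] := reduced_even px.
have [r er] := braid_word_head nij; have [r' er'] := braid_word_head ji.
have sbw : size (braid_word i j) = size (braid_word j i) by case: (i); case: (j).
have e1 : word_elt (braid_word j i ++ u) =
    x by rewrite word_elt_cat -eu word_elt_braidK.
have e2 : word_elt (braid_word i j ++ u) = x.
  by rewrite word_elt_cat word_elt_braid -word_elt_cat.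
have s1 : size (braid_word i j ++ u) = alen x.
  by rewrite size_cat su (alen_braid nij di dj).
have s2 : size (braid_word j i ++ u) = alen x by rewrite size_cat -sbw -size_cat.
transitivity (word_op (braid_word i j ++ u) y).
  by move: e2 s1; rewrite er => e2 s1; apply: key.
transitivity (word_op (braid_word j i ++ u) y); first by rewrite !word_op_cat braid.
by move: e1 s2; rewrite er' => e1 s2; apply: key.
Qed.

End Matsumoto.

(** * Oriented reflection operators *)

Section Operators.
Variables (R : comNzRingType) (xi : R) (X : Type).
Implicit Types (f : X -> R) (x : X).

(** A Hecke generator acting on functions on a set with an involution [s]. The sign
    of [c] tells on which side of the wall of [s] a point lies: the operator is
    the involution plus xi times the indicator of the negative side. On the wall
    it is the scalar [q], a root of the quadratic relation. For xi = 0 and q = 1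
    only the involution remains. *)
Definition refl_op (c : X -> int) (s : X -> X) (q : X -> R) f : X -> R :=
  fun x => if c x == 0 then q x * f x
           else f (s x) + (if c x < 0 then xi else 0) * f x.

Lemma refl_op_quad c s q f : (forall x, c (s x) = - c x) -> involutive s ->
    (forall x, q x * q x = xi * q x + 1) ->
  refl_op c s q (refl_op c s q f) = fun x => xi * refl_op c s q f x + f x.
Proof.
move=> cs ss qq; apply/funext => x; rewrite /refl_op cs ss.
repeat (case: ifP => ?; try (exfalso; lia)); last 2 first.
- by ring.
- by ring.
- by ring: (qq x).
Qed.

Lemma refl_op_comm c c' s s' q q' f :
    (forall x, c (s' x) = c x) -> (forall x, c' (s x) = c' x) ->
    (forall x, q (s' x) = q x) -> (forall x, q' (s x) = q' x) ->
    (forall x, s (s' x) = s' (s x)) ->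
  refl_op c s q (refl_op c' s' q' f) = refl_op c' s' q' (refl_op c s q f).
Proof.
move=> cs cs' qs qs' ss; apply/funext => x.
rewrite /refl_op !cs !cs' !qs !qs' ss.
by repeat case: ifP => _; ring.
Qed.

(** The values of c1 and c2 transform like two simple roots of type B2, so the
    sector that contains (c1, c2) decides all the signs met along both sides, and
    each of the sectors and rays leaves a ring identity. *)
Lemma refl_op_braid c1 c2 s1 s2 q1 q2 f :
    (forall x, c1 (s1 x) = - c1 x) -> (forall x, c2 (s2 x) = - c2 x) ->
    (forall x, c1 (s2 x) = c1 x + c2 x) -> (forall x, c2 (s1 x) = 2 * c1 x + c2 x) ->
    involutive s1 -> involutive s2 ->
    (forall x, s1 (s2 (s1 (s2 x))) = s2 (s1 (s2 (s1 x)))) ->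
    (forall x, q1 (s1 x) = q1 x) -> (forall x, q1 (s2 x) = q1 x) ->
    (forall x, q2 (s1 x) = q2 x) -> (forall x, q2 (s2 x) = q2 x) ->
    (forall x, q1 x * q1 x = xi * q1 x + 1) ->
    (forall x, q2 x * q2 x = xi * q2 x + 1) ->
  let T1 := refl_op c1 s1 q1 in let T2 := refl_op c2 s2 q2 in
  T1 (T2 (T1 (T2 f))) = T2 (T1 (T2 (T1 f))).
Proof.
move=> c11 c22 c12 c21 i1 i2 br q11 q12 q21 q22 qq1 qq2 T1 T2.
apply/funext => x; rewrite /T1 /T2 /refl_op.
do 4 rewrite ?(c11, c22, c12, c21, i1, i2, br, q11, q12, q21, q22).
have := qq1 x; have := qq2 x; move: (q1 x) (q2 x) (c1 x) (c2 x) => a b m n hb ha.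
case: (ltgtP m 0) => hm; case: (ltgtP n 0) => hn;
  case: (ltgtP (m + n) 0) => hmn; try (exfalso; lia);
  case: (ltgtP (2 * m + n) 0) => hmmn; try (exfalso; lia).
all: repeat (case: ifP => ?; try (exfalso; lia)).
all: by ring: ha hb.
Qed.
End Operators.

(** * From generators to the whole group, and traces of finite operators *)

Definition swap02 (i : gen) : gen := match i with G0 => G2 | G1 => G1 | G2 => G0 end.

Lemma omega_srefl i x : (omega * (srefl i * x))%g = (srefl (swap02 i) * (omega * x))%g.
Proof.
rewrite !mulgA; congr (_ * _)%g.
by case: i; apply: val_inj; rewrite !val_mul !val_srefl val_omega [_.1]/= [_.2]/= !affE.
Qed.

Lemma reduced_pair x : exists p : seq gen * bool,
  x = (word_elt p.1 * omega_pow p.2)%g /\ size p.1 = alen x.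
Proof. by have [ws [e h]] := reduced_exists x; exists (ws, e). Qed.

Definition reduced_word x : seq gen * bool := projT1 (cid (reduced_pair x)).

Lemma reduced_wordP x : x = (word_elt (reduced_word x).1 *
    omega_pow (reduced_word x).2)%g /\
  size (reduced_word x).1 = alen x.
Proof. exact: (projT2 (cid (reduced_pair x))). Qed.

Section Rho.
Variables (Y : Type) (t : gen -> Y -> Y) (u : Y -> Y).
Hypothesis braid : forall i j y, word_op t (braid_word i j) y =
    word_op t (braid_word j i) y.
Hypothesis u2 : forall y, u (u y) = y.
Hypothesis ut : forall i y, u (t i y) = t (swap02 i) (u y).

(** The operator of a group element, through one chosen reduced word; the lemmas
    below use that any other reduced word gives the same operator. *)
Definition word_rep (x : affW) (y : Y) : Y :=
  word_op t (reduced_word x).1 (if (reduced_word x).2 then u y else y).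

Lemma word_repE ws e x y : x = (word_elt ws * omega_pow e)%g -> size ws = alen x ->
  word_rep x y = word_op t ws (if e then u y else y).
Proof.
move=> ex es; have [] := reduced_wordP x; rewrite /word_rep; case:
    (reduced_word x) => ws' e' /=.
move=> ex' es'.
have ee : e' = e.
  by have := congr1 parity ex; rewrite {1}ex' !parity_mul !parity_word
      !parity_omega_pow.
have ew : word_elt ws' = word_elt ws by apply: (mulIg (omega_pow e)); rewrite -ex -ee.
rewrite ee; apply: matsumoto => //; rewrite ew.
  by rewrite es' ex alen_mul_omega_pow.
by rewrite es {1}ex alen_mul_omega_pow.
Qed.

Lemma word_rep_one y : word_rep 1%g y = y.
Proof. by rewrite (@word_repE [::] false) ?alen_one //= mulg1. Qed.

Lemma word_rep_srefl i x y : alen (srefl i * x)%g = (alen x).+1 ->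
    word_rep (srefl i * x)%g y = t i (word_rep x y).
Proof.
move=> Lx; have [ex es] := reduced_wordP x.
rewrite (@word_repE (i :: (reduced_word x).1) (reduced_word x).2) //=.
  by rewrite -mulgA -ex.
by rewrite es Lx.
Qed.

Lemma omega_word ws : (omega * word_elt ws)%g = (word_elt (map swap02 ws) * omega)%g.
Proof.
by elim: ws => [|i ws IH] /=; rewrite ?mulg1 ?mul1g // omega_srefl IH mulgA.
Qed.

Lemma u_word_op ws y : u (word_op t ws y) = word_op t (map swap02 ws) (u y).
Proof. by elim: ws => //= i ws IH; rewrite ut IH. Qed.

Lemma word_rep_omega x y : word_rep (omega * x)%g y = u (word_rep x y).
Proof.
have [ex es] := reduced_wordP x.
rewrite (@word_repE (map swap02 (reduced_word x).1) (~~ (reduced_word x).2)).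
- rewrite /word_rep u_word_op; congr word_op; by case: (reduced_word x).2; rewrite /=
    ?u2.
- rewrite {1}ex mulgA omega_word -!mulgA; congr (_ * _)%g.
  by case: (reduced_word x).2; rewrite /= ?omega2 ?mulg1.
- by rewrite size_map es alen_omega.
Qed.
End Rho.

Section Trace.
Variables (R : comNzRingType) (X : eqType) (B : seq X).
Hypothesis uB : uniq B.
Local Notation op := ((X -> R) -> (X -> R)).
Implicit Types (f : X -> R) (x y : X).

Definition dirac y : X -> R := fun x => (x == y)%:R.

(** Operators on functions on an arbitrary set which, on the finite set [B], are
    given by a matrix. Working with functions on the whole set makes composition
    of operators strict, while [B] carries the trace. *)
Definition kernel_op (l : op) : Prop :=
  exists K, forall f, {in B, forall x, l f x = \sum_(y <- B) K x y * f y}.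

Definition optrace (l : op) : R := \sum_(x <- B) l (dirac x) x.

Lemma sum_dirac (K : X -> R) y : y \in B -> \sum_(x <- B) K x * dirac y x = K y.
Proof.
move=> yB; rewrite (bigD1_seq y) //= /dirac eqxx mulr1 big1 ?addr0 // => x /negPf->.
by rewrite mulr0.
Qed.

Lemma kernel_op_comp l l' : kernel_op l -> kernel_op l' -> kernel_op (l \o l').
Proof.
move=> [K hK] [K' hK']; exists (fun x z => \sum_(y <- B) K x y * K' y z) => f x xB.
rewrite /= hK // (eq_big_seq (fun y => K x y * \sum_(z <- B) K' y z * f z)).
  under eq_bigr do rewrite big_distrr.
  rewrite exchange_big; apply: eq_bigr => z _ /=.
  by rewrite big_distrl; apply: eq_bigr => y _; rewrite mulrA.
by move=> y yB; rewrite hK'.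
Qed.

Lemma optraceC l l' : kernel_op l -> kernel_op l' ->
  optrace (l \o l') = optrace (l' \o l).
Proof.
move=> [K hK] [K' hK'].
have E l1 l2 K1 K2 : (forall f, {in B, forall x, l1 f x = \sum_(y <- B) K1 x y *
    f y}) ->
    (forall f, {in B, forall x, l2 f x = \sum_(y <- B) K2 x y * f y}) ->
    optrace (l1 \o l2) = \sum_(x <- B) \sum_(y <- B) K1 x y * K2 y x.
  move=> h1 h2; apply: eq_big_seq => x xB /=; rewrite h1 //.
  by apply: eq_big_seq => y yB; rewrite h2 // sum_dirac.
rewrite (E _ _ _ _ hK hK') (E _ _ _ _ hK' hK) exchange_big.
by do 2 (apply: eq_bigr => ? _); rewrite mulrC.
Qed.

Lemma kernel_op_pull (s : X -> X) : {in B, forall x, s x \in B} ->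
  kernel_op (fun f => f \o s).
Proof.
move=> sB; exists (fun x y => dirac (s x) y) => f x xB /=.
by under eq_bigr do rewrite mulrC; rewrite sum_dirac // sB.
Qed.

Lemma kernel_op_refl xi c s q : {in B, forall x, s x \in B} ->
  kernel_op (refl_op xi c s q).
Proof.
move=> sB; exists (fun x y => if c x == 0 then q x * dirac x y
   else dirac (s x) y + (if c x < 0 then xi else 0) * dirac x y) => f x xB.
rewrite /refl_op; case: ifP => _.
  by rewrite -{1}(sum_dirac f xB) big_distrr; apply: eq_bigr => y _ /=; ring.
rewrite -{1}(sum_dirac f (sB _ xB)) -{1}(sum_dirac f xB) big_distrr -big_split.
by apply: eq_bigr => y _ /=; ring.
Qed.
End Trace.

(** * Operators on affine functionals *)

Section Points.
Variable N : nat.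
(** Points are integral affine functionals on the weight lattice: the values h and k
    of the linear part at eps1 and eps2, and a constant term taken modulo N so
    that Weyl group orbits are finite. The boolean records parity. *)
Definition affun : Type := (int * int * 'Z_N * bool)%type.
HB.instance Definition _ := Equality.on affun.

Implicit Types (x : affun) (i : gen).

(** The pairing of the linear part with the simple coroots (halved for alpha_1), and
    with minus the highest coroot for s_0. Its sign orients each family of
    parallel hyperplanes in the same way at infinity; this is what makes the
    operators below satisfy the Hecke relations and commute with adding constants. *)
Definition wall i x : int := let: (h, k, _, _) := x in
  match i with G0 => - h | G1 => h - k | G2 => 2 * k - h end.

Definition flip i x : affun := let: (h, k, n, e) := x in
  match i with
  | G0 => (- h, k - h, n + h%:~R, e)
  | G1 => (2 * k - h, k, n, e)
  | G2 => (h, h - k, n, e)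
  end.

Definition flip_omega x : affun := let: (h, k, n, e) :=
    x in (h - 2 * k, - k, n + k%:~R, ~~ e).

Definition shift (m : 'Z_N) (c : bool) x : affun :=
  let: (h, k, n, e) := x in (h, k, n + m, e (+) c).

Lemma affun_eq (h k h' k' : int) (n n' : 'Z_N) (e e' : bool) :
  h = h' -> k = k' -> n = n' -> e = e' -> (h, k, n, e) = (h', k', n', e') :> affun.
Proof. by move=> -> -> -> ->. Qed.

Lemma flipK i : involutive (flip i).
Proof. by move=> [[[h k] n] e]; case: i; apply: affun_eq => //; ring. Qed.

Lemma flip_omegaK : involutive flip_omega.
Proof. by move=> [[[h k] n] e]; apply: affun_eq; rewrite ?negbK //; ring. Qed.

Lemma wall_flip i x : wall i (flip i x) = - wall i x.
Proof. by case: x => [[[h k] n] e]; case: i => /=; ring. Qed.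

Lemma wall_flip_omega i x : wall i (flip_omega x) = wall (swap02 i) x.
Proof. by case: x => [[[h k] n] e]; case: i => /=; ring. Qed.

Lemma flip_flip_omega i x : flip i (flip_omega x) = flip_omega (flip (swap02 i) x).
Proof.
by case: x => [[[h k] n] e]; case: i; apply: affun_eq => //; ring.
Qed.

Lemma shift_flip m c i x : shift m c (flip i x) = flip i (shift m c x).
Proof. by case: x => [[[h k] n] e]; case: i; apply: affun_eq => //; ring. Qed.

Lemma shift_flip_omega m c x : shift m c (flip_omega x) = flip_omega (shift m c x).
Proof.
case: x => [[[h k] n] e]; apply: affun_eq; rewrite ?addNb //; ring.
Qed.

Lemma wall_shift m c i x : wall i (shift m c x) = wall i x.
Proof. by case: x => [[[h k] n] e]. Qed.

Section Rep.
Variables (R : comNzRingType) (xi q1 : R) (q2 : bool -> R).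

(** The scalars of s_0 and s_2 are exchanged when the parity changes, as required by
    conjugation with [tau]. *)
Definition fixed_scalar i x : R :=
  match i with G0 => q2 (~~ x.2) | G1 => q1 | G2 => q2 x.2 end.

Definition hecke_op i : (affun -> R) -> (affun -> R) :=
    refl_op xi (wall i) (flip i) (fixed_scalar i).
Definition omega_op (f : affun -> R) : affun -> R := f \o flip_omega.
Definition shift_op m c (f : affun -> R) : affun -> R := f \o shift m c.
(** Functionals with regular linear part carry principal series modules; those with a
    linear part on a wall, modules induced from a one dimensional character of
    a Levi subalgebra; for the zero functional,
        a sum of two characters of the Hecke algebra
    of W_a that [tau] exchanges. *)
Definition orient_rep : affW -> (affun -> R) -> (affun -> R) :=
    word_rep hecke_op omega_op.

Lemma fixed_scalar_flip i j x : fixed_scalar i (flip j x) = fixed_scalar i x.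
Proof. by case: x => [[[h k] n] e]; case: i; case: j. Qed.

Lemma omega_opK f : omega_op (omega_op f) = f.
Proof. by apply/funext => x; rewrite /omega_op /= flip_omegaK. Qed.

Lemma omega_hecke_op i f : omega_op (hecke_op i f) = hecke_op (swap02 i) (omega_op f).
Proof.
apply/funext => x; rewrite /omega_op /hecke_op /refl_op /=
    wall_flip_omega flip_flip_omega.
by rewrite (_ : fixed_scalar i (flip_omega x) = fixed_scalar (swap02 i) x) //;
  case: x => [[[h k] n] e]; case: i => //=; rewrite negbK.
Qed.

Hypothesis qq1 : q1 * q1 = xi * q1 + 1.
Hypothesis qq2 : forall e, q2 e * q2 e = xi * q2 e + 1.

Lemma fixed_scalarP i x : fixed_scalar i x * fixed_scalar i x = xi *
    fixed_scalar i x + 1.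
Proof. by case: i; rewrite /fixed_scalar. Qed.

Lemma hecke_op_quad i f : hecke_op i (hecke_op i f) = fun x => xi *
    hecke_op i f x + f x.
Proof. exact/refl_op_quad/fixed_scalarP/flipK/wall_flip. Qed.

Lemma hecke_op_braid i j f : word_op hecke_op (braid_word i j) f =
    word_op hecke_op (braid_word j i) f.
Proof.
have br a : a <> G1 ->
    hecke_op G1 (hecke_op a (hecke_op G1 (hecke_op a f))) =
        hecke_op a (hecke_op G1 (hecke_op a (hecke_op G1 f))).
  move=> ha; apply: refl_op_braid; try exact: flipK; try exact: wall_flip;
    try (by move=> x; apply: fixed_scalar_flip);
        try (by move=> x; apply: fixed_scalarP);
  by case=> [[[h k] n] e]; case: a ha => //= _; rewrite /=; try apply:
      affun_eq => //; ring.
have cm : hecke_op G0 (hecke_op G2 f) = hecke_op G2 (hecke_op G0 f).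
  apply: refl_op_comm; try (by move=> x; apply: fixed_scalar_flip);
  by case=> [[[h k] n] e] /=; try apply: affun_eq => //; ring.
by case: i; case: j => //=; rewrite ?cm ?br.
Qed.

Lemma orient_rep_one f : orient_rep 1%g f = f.
Proof. exact/word_rep_one/hecke_op_braid. Qed.

Lemma orient_rep_srefl i w f : alen (srefl i * w)%g = (alen w).+1 ->
    orient_rep (srefl i * w)%g f = hecke_op i (orient_rep w f).
Proof. exact/word_rep_srefl/hecke_op_braid. Qed.

Lemma orient_rep_omega w f : orient_rep (omega * w)%g f = omega_op (orient_rep w f).
Proof. exact: (word_rep_omega hecke_op_braid omega_opK omega_hecke_op). Qed.

Lemma shift_op_rep m c w f : (forall e, q2 (e (+) c) = q2 e) ->
  shift_op m c (orient_rep w f) = orient_rep w (shift_op m c f).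
Proof.
move=> qc.
have hi i g : shift_op m c (hecke_op i g) = hecke_op i (shift_op m c g).
  apply/funext => x; rewrite /shift_op /hecke_op /refl_op /= wall_shift shift_flip.
  by rewrite (_ : fixed_scalar i (shift m c x) = fixed_scalar i x) //;
     case: x => [[[h k] n] e]; case: i; rewrite /= -?addNb ?qc.
elim/affW_ind: w => [|w IH|i w IH Lw]; first by rewrite !orient_rep_one.
  rewrite !orient_rep_omega -IH; apply/funext => x.
  by rewrite /shift_op /omega_op /= shift_flip_omega.
by rewrite !orient_rep_srefl // hi IH.
Qed.

Section TwistedTrace.
Variables (B : seq affun) (m : 'Z_N) (c : bool).
Hypothesis uB : uniq B.
Hypothesis flipB : forall i, {in B, forall x, flip i x \in B}.
Hypothesis ompB : {in B, forall x, flip_omega x \in B}.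
Hypothesis shiftB : {in B, forall x, shift m c x \in B}.
Hypothesis q2c : forall e, q2 (e (+) c) = q2 e.

(** The trace of [w] followed by a shift of the constant term and of the parity. The
    shift commutes with the representation and extracts one Fourier coefficient
    of the character of an induced module. *)
Definition twisted_trace w : R := optrace B (orient_rep w \o shift_op m c).

Lemma kernel_orient_rep w : kernel_op B (orient_rep w).
Proof.
have ext l l' : (forall f, l f = l' f) -> kernel_op B l -> kernel_op (R := R) B l'.
  by move=> e [K hK]; exists K => f x xB; rewrite -e hK.
elim/affW_ind: w => [|w IH|i w IH Lw].
- apply: (@ext (fun f => f \o id)) => [f|]; first by rewrite orient_rep_one.
  exact: kernel_op_pull.
- apply: (@ext (omega_op \o orient_rep w)) => [f|]; first by rewrite orient_rep_omega.
  by apply: kernel_op_comp => //; apply: kernel_op_pull.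
- apply: (@ext (hecke_op i \o orient_rep w)) => [f|]; first by rewrite orient_rep_srefl.
  by apply: kernel_op_comp => //; apply: kernel_op_refl uB _ _ _ _ _; apply: flipB.
Qed.

Lemma kernel_shift_op : kernel_op B (shift_op m c : (affun -> R) -> (affun -> R)).
Proof. exact: kernel_op_pull. Qed.

(** Invariance of the trace under cyclic permutation, combined with the fact that the
    shift commutes with every operator. *)
Lemma twisted_trace_comm w w' :
  optrace B (orient_rep w \o orient_rep w' \o shift_op m c) =
      optrace B (orient_rep w' \o orient_rep w \o shift_op m c).
Proof.
have -> : orient_rep w \o orient_rep w' \o shift_op m c =
    orient_rep w \o (shift_op m c \o orient_rep w').
  by apply/funext => f /=; rewrite shift_op_rep.
rewrite (optraceC uB (kernel_orient_rep w)
    (kernel_op_comp kernel_shift_op (kernel_orient_rep w'))).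
by congr optrace; apply/funext => f /=; rewrite !shift_op_rep.
Qed.
End TwistedTrace.
End Rep.

(** The reduced words do not depend on the coefficients, so the representations are
    compatible with change of rings. *)
Lemma orient_rep_rmorph (R R' : comNzRingType) (g : {rmorphism R -> R'}) xi q1 q2 w f :
  orient_rep (g xi) (g q1) (g \o q2) w (g \o f) = g \o orient_rep xi q1 q2 w f.
Proof.
rewrite /orient_rep /word_rep; set f1 := if _ then _ else _; set f2 :=
    if _ then _ else _.
have -> : f1 = g \o f2 by rewrite /f1 /f2; case: ifP.
elim: (reduced_word w).1 => //= i ws ->; apply/funext => x.
rewrite /hecke_op /refl_op /=; case: ifP => _; rewrite ?rmorphD !rmorphM //.
  by congr (_ * _); case: i.
by congr (_ + _ * _); case: ifP; rewrite ?rmorph0.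
Qed.
End Points.

(** * Trace functions on the Hecke algebra *)

Section HeckeFunctional.
Variables (H : algType laurent) (T : affW -> H).
Hypothesis hT : is_hecke_algebra T.
Local Notation combo := (seq (laurent * affW)).

Definition combine (ps : combo) : H := \sum_(p <- ps) p.1 *: T p.2.

Lemma combine_exists h : exists ps, h = combine ps.
Proof.
have [[span _] _ _] := hT; have [xs [a ->]] := span h.
by exists [seq (a x, x) | x <- xs]; rewrite /combine big_map.
Qed.

Definition decomp h : combo := projT1 (cid (combine_exists h)).
Lemma decompP h : h = combine (decomp h).
Proof. exact: (projT2 (cid (combine_exists h))). Qed.

Implicit Types (phi : affW -> laurent) (h : H).
(** The linear extension of a function on the basis, read off from one chosen
    decomposition; [combine_eq0] makes it independent of the choice. *)
Definition linext phi h : laurent := \sum_(p <- decomp h) p.1 * phi p.2.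

Lemma combine_eq0 phi ps : combine ps = 0 -> \sum_(p <- ps) p.1 * phi p.2 = 0.
Proof.
have [[_ free] _ _] := hT.
pose xs := undup (map snd ps); pose a x := \sum_(p <- ps | p.2 == x) p.1.
have split (V : lmodType laurent) (g : affW -> V) :
    \sum_(p <- ps) p.1 *: g p.2 = \sum_(x <- xs) a x *: g x.
  under [RHS]eq_bigr do rewrite scaler_suml big_mkcond.
  rewrite exchange_big /= big_seq [RHS]big_seq; apply: eq_bigr => p pps.
  rewrite (bigD1_seq p.2) ?undup_uniq //=; last by rewrite mem_undup map_f.
  by rewrite eqxx big1 ?addr0 // => x; rewrite eq_sym => /negPf->.
rewrite /combine (split H T) => /(free xs a (undup_uniq _)) a0.
have -> := split laurent^o phi.
by rewrite big_seq big1 // => x /a0->; rewrite scale0r.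
Qed.

Lemma linextE phi ps h : h = combine ps -> linext phi h = \sum_(p <- ps) p.1 * phi p.2.
Proof.
move=> hps.
have /(combine_eq0 phi) : combine (decomp h ++ [seq (- p.1, p.2) | p <- ps]) = 0.
  rewrite /combine big_cat big_map /= -/(combine _) -decompP.
  under eq_bigr do rewrite scaleNr.
  by rewrite sumrN -/(combine _) -hps subrr.
rewrite big_cat big_map /=; under [X in _ + X]eq_bigr do rewrite mulNr.
by rewrite sumrN => /eqP; rewrite subr_eq0 => /eqP.
Qed.

Lemma linext_basis phi x : linext phi (T x) = phi x.
Proof.
by rewrite (@linextE _ [:: (1, x)]) /combine big_seq1 ?mul1r //= scale1r.
Qed.

Lemma linextD phi h h' : linext phi (h + h') = linext phi h + linext phi h'.
Proof.
rewrite (@linextE _ (decomp h ++ decomp h')) ?big_cat //.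
by rewrite /combine big_cat /= -!/(combine _) -!decompP.
Qed.

Lemma linextZ phi a h : linext phi (a *: h) = a * linext phi h.
Proof.
rewrite (@linextE _ [seq (a * p.1, p.2) | p <- decomp h]) ?big_map.
  by rewrite /linext big_distrr; apply: eq_bigr => p _ /=; rewrite mulrA.
rewrite {1}[h]decompP /combine big_map scaler_sumr.
by apply: eq_bigr => p _; rewrite scalerA.
Qed.

Lemma linext0 phi : linext phi 0 = 0.
Proof. by rewrite -(scale0r 0) linextZ mul0r. Qed.

Lemma linext_sum phi (I : Type) (r : seq I) (F : I -> H) :
  linext phi (\sum_(i <- r) F i) = \sum_(i <- r) linext phi (F i).
Proof. exact: (big_morph _ (linextD phi) (linext0 phi)). Qed.

Lemma linext_comp phi h (F : H -> H) :
    (forall a h', F (a *: h') = a *: F h') -> {morph F : x y / x + y} -> F 0 = 0 ->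
  linext phi (F h) = linext (fun x => linext phi (F (T x))) h.
Proof.
move=> FZ FD F0; rewrite {1}[h]decompP /combine (big_morph F FD F0) linext_sum
    [RHS]/linext.
by apply: eq_bigr => p _; rewrite FZ linextZ.
Qed.

Lemma linext_mull phi h h' : linext phi (h * h') =
    linext (fun x => linext phi (h * T x)) h'.
Proof.
apply: (linext_comp phi h' (F := fun z => h * z)) => [a z|z z'|].
- by rewrite scalerAr.
- by rewrite mulrDr.
- by rewrite mulr0.
Qed.

Lemma linext_mulr phi h h' : linext phi (h * h') =
    linext (fun x => linext phi (T x * h')) h.
Proof.
apply: (linext_comp phi h (F := fun z => z * h')) => [a z|z z'|].
- by rewrite scalerAl.
- by rewrite mulrDl.
- by rewrite mul0r.
Qed.

Definition trace_like phi := forall x y, linext phi (T x * T y) =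
    linext phi (T y * T x).

Lemma trace_like_comm phi h : trace_like phi -> comm_submod h -> linext phi h = 0.
Proof.
move=> tr [ts ->]; rewrite linext_sum big1 // => -[a [h1 h2]] _ /=.
rewrite linextZ -scaleN1r linextD linextZ mulN1r.
have -> : linext phi (h1 * h2) = linext phi (h2 * h1).
  rewrite linext_mulr linext_mull; congr linext; apply/funext => x.
  by rewrite linext_mull linext_mulr; congr linext; apply/funext => y.
by rewrite subrr mulr0.
Qed.

Lemma T_mul x y : (alen x + alen y)%N = alen (x * y)%g -> T x * T y = T (x * y)%g.
Proof. by move=> Lxy; apply: hecke_mul; rewrite ?lenE. Qed.

Lemma lv_lvinv : lv * lvinv = 1.
Proof. by apply: val_inj => /=; rewrite mulfV // -unitfE fracv_unit. Qed.

Definition lxi : laurent := lv - lvinv.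

Lemma T_quad i : T (srefl i) * T (srefl i) = lxi *: T (srefl i) + 1.
Proof.
have [_ _ /(_ (srefl i) (srefl_simple i))] := hT.
rewrite mulrDr !mulrBl -!scalerAl -!scalerAr !mul1r !mulr1 scalerA lv_lvinv scale1r.
move/eqP; rewrite addrA subr_eq0 => /eqP <-.
by rewrite /lxi scalerBl (addrC (_ - _) (lvinv *: _)) addrA subrK addrC subrK.
Qed.

Lemma alen_srefl1 i : alen (srefl i) = 1%N.
Proof.
have := alen_srefl i 1%g; rewrite mulg1 alen_one.
case: ifP => [_|_ ->] //; by case: (i).
Qed.

Lemma T_srefl i x : T (srefl i) * T x =
  if descent i x then lxi *: T x + T (srefl i * x)%g else T (srefl i * x)%g.
Proof.
have := alen_srefl i x; case: ifP => di Lx; last by rewrite T_mul // alen_srefl1 Lx.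
have e : T x = T (srefl i) * T (srefl i * x)%g by rewrite T_mul sreflK // alen_srefl1
    Lx.
by rewrite e mulrA T_quad mulrDl mul1r -scalerAl.
Qed.

Lemma T_omega x : T omega * T x = T (omega * x)%g.
Proof. by rewrite T_mul // alen_omega -[omega]mulg1 alen_omega alen_one. Qed.

Section RepTrace.
Variables (N : nat) (q1 : laurent) (q2 : bool -> laurent).
Hypothesis qq1 : q1 * q1 = lxi * q1 + 1.
Hypothesis qq2 : forall e, q2 e * q2 e = lxi * q2 e + 1.

Let rep := @orient_rep N _ lxi q1 q2.
Definition hecke_act h (f : affun N -> laurent) : affun N -> laurent :=
  fun x => linext (fun w => rep w f x) h.

Lemma hecke_act_srefl i h f : hecke_act (T (srefl i) * h) f =
    hecke_op lxi q1 q2 i (hecke_act h f).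
Proof.
apply/funext => x; rewrite /hecke_act linext_mull.
have -> : (fun y => linext (fun w => rep w f x) (T (srefl i) * T y)) =
          (fun y => hecke_op lxi q1 q2 i (rep y f) x).
  apply/funext => y; rewrite T_srefl; have := alen_srefl i y; case: ifP => di Ly.
    rewrite linextD linextZ !linext_basis.
    have -> : rep y f = hecke_op lxi q1 q2 i (rep (srefl i * y)%g f).
      by rewrite -orient_rep_srefl // sreflK.
    by rewrite hecke_op_quad.
  by rewrite linext_basis /rep orient_rep_srefl.
rewrite /hecke_op /refl_op /linext; move: (if wall i x < 0 then _ else _) => z.
case: (wall i x == 0).
  by rewrite big_distrr; apply: eq_bigr => p _ /=; ring.
by rewrite big_distrr -big_split; apply: eq_bigr => p _ /=; ring.
Qed.

Lemma hecke_act_omega h f : hecke_act (T omega * h) f = omega_op (hecke_act h f).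
Proof.
apply/funext => x; rewrite /hecke_act linext_mull /omega_op /=; congr linext;
    apply/funext => y.
by rewrite T_omega linext_basis /rep orient_rep_omega.
Qed.

(** The representation is multiplicative on the Hecke algebra: the quadratic relation
    of the algebra matches the one of the operators. *)
Lemma hecke_act_mul x y f : hecke_act (T x * T y) f = rep x (rep y f).
Proof.
elim/affW_ind: x => [|x IH|i x IH Lx].
- rewrite T_mul ?alen_one ?mul1g // /rep orient_rep_one //.
  by apply/funext => z; rewrite /hecke_act linext_basis.
- by rewrite -T_omega -mulrA hecke_act_omega IH /rep orient_rep_omega.
- rewrite -T_mul; last by rewrite alen_srefl1 Lx.
  by rewrite -mulrA hecke_act_srefl IH /rep orient_rep_srefl.
Qed.

Lemma twisted_trace_trace_like (B : seq (affun N)) m c : uniq B ->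
    (forall i, {in B, forall x, flip i x \in B}) ->
    {in B, forall x, flip_omega x \in B} -> {in B, forall x, shift m c x \in B} ->
    (forall e, q2 (e (+) c) = q2 e) ->
  trace_like (twisted_trace lxi q1 q2 B m c).
Proof.
move=> uB fB oB sB qc x y.
have E h : linext (twisted_trace lxi q1 q2 B m c) h =
    optrace B (hecke_act h \o shift_op m c).
  rewrite /linext /optrace; under eq_bigr do rewrite /twisted_trace /optrace big_distrr.
  by rewrite exchange_big.
rewrite !E.
have A x' y' : hecke_act (T x' * T y') \o shift_op m c =
    rep x' \o rep y' \o shift_op m c.
  by apply/funext => f /=; rewrite hecke_act_mul.
by rewrite !A; apply: twisted_trace_comm.
Qed.
End RepTrace.
End HeckeFunctional.

(** * Laurent polynomials at v = 1 *)

Definition vpoly (p : {poly int}) : laurent := (map_poly intr p).[lv].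

Lemma vpolyD p q : vpoly (p + q) = vpoly p + vpoly q.
Proof. by rewrite /vpoly rmorphD hornerD. Qed.
Lemma vpolyB p q : vpoly (p - q) = vpoly p - vpoly q.
Proof. by rewrite /vpoly rmorphB hornerD hornerN. Qed.
Lemma vpolyM p q : vpoly (p * q) = vpoly p * vpoly q.
Proof. by rewrite /vpoly rmorphM hornerM. Qed.
Lemma vpolyC c : vpoly c%:P = c%:~R.
Proof. by rewrite /vpoly map_polyC hornerC. Qed.
Lemma vpolyX : vpoly 'X = lv.
Proof. by rewrite /vpoly map_polyX hornerX. Qed.
Lemma vpolyXn n : vpoly 'X^n = lv ^+ n.
Proof. by rewrite /vpoly map_polyXn hornerXn. Qed.

Lemma val_vpoly p : val (vpoly p) = tofrac p.
Proof.
elim/poly_ind: p => [|p c IH]; first by rewrite -[0]/(0%:P) vpolyC tofrac0.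
rewrite vpolyD vpolyM vpolyX vpolyC rmorphD rmorphM [RHS]rmorphD [in RHS]rmorphM /= -IH.
congr (_ + _); transitivity (c%:~R : {fraction {poly int}}).
  exact: (raddfMz (val : {additive laurent -> {fraction {poly int}}}) c 1).
by rewrite (_ : c%:P = c%:~R) ?rmorph_int // -[c in LHS]intz rmorph_int.
Qed.

Lemma vpoly_inj : injective vpoly.
Proof.
move=> p q /(congr1 val); rewrite !val_vpoly => /eqP; rewrite tofrac_eq => /eqP //.
Qed.

Lemma laurent_form a : exists pn : {poly int} * nat, a = vpoly pn.1 * lvinv ^+ pn.2.
Proof.
have /set_mem[p [n e]] := valP a; exists (p, n); apply: val_inj.
by rewrite rmorphM rmorphXn /= val_vpoly e exprVn.
Qed.

Lemma lvinvK n : lvinv ^+ n * lv ^+ n = 1.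
Proof. by rewrite -exprMn mulrC lv_lvinv expr1n. Qed.

(** The specialization v = 1, through any expression p(v) / v^n; [at1E] shows that the
    expression does not matter. *)
Definition at1 (a : laurent) : int := (projT1 (cid (laurent_form a))).1.[1].

Lemma at1E p n : at1 (vpoly p * lvinv ^+ n) = p.[1].
Proof.
rewrite /at1; case: cid => -[q m] /= e.
have {e} : vpoly (p * 'X^m) = vpoly (q * 'X^n).
  rewrite !vpolyM !vpolyXn; move: e (lvinvK n) (lvinvK m).
  move: (lv ^+ n) (lv ^+ m) (lvinv ^+ n) (lvinv ^+ m) => a b a' b' e ha hb.
  transitivity (vpoly p * a' * (a * b)); first by ring: ha.
  by rewrite e; ring: hb.
move/vpoly_inj/(congr1 (horner^~ 1)); by rewrite !hornerM !hornerXn !expr1n !mulr1.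
Qed.

Lemma at1_vpoly p : at1 (vpoly p) = p.[1].
Proof. by rewrite -(at1E p 0) expr0 mulr1. Qed.

Lemma at1_zmod : zmod_morphism at1.
Proof.
move=> a b; have [[p n] /= ->] := laurent_form a; have [[q m] /= ->] := laurent_form b.
rewrite !at1E.
have -> : vpoly p * lvinv ^+ n - vpoly q * lvinv ^+ m =
    vpoly (p * 'X^m - q * 'X^n) * lvinv ^+ (n + m).
  rewrite vpolyB !vpolyM !vpolyXn exprD; move: (lvinvK n) (lvinvK m).
  move: (lv ^+ n) (lv ^+ m) (lvinv ^+ n) (lvinv ^+ m) => c d c' d' hc hd.
  by ring: hc hd.
by rewrite at1E !(hornerE, hornerXn, expr1n, mulr1).
Qed.

Lemma at1_monoid : monoid_morphism at1.
Proof.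
split; first by rewrite -[1 in LHS]/(1%:~R) -vpolyC at1_vpoly hornerC.
move=> a b; have [[p n] /= ->] := laurent_form a; have [[q m] /= ->] := laurent_form b.
by rewrite mulrACA -vpolyM -exprD !at1E hornerM.
Qed.

HB.instance Definition _ := GRing.isZmodMorphism.Build _ _ at1 at1_zmod.
HB.instance Definition _ := GRing.isMonoidMorphism.Build _ _ at1 at1_monoid.

Lemma at1_lv : at1 lv = 1.
Proof. by rewrite -vpolyX at1_vpoly hornerX. Qed.

Lemma at1_lvinv : at1 lvinv = 1.
Proof.
have := at1_monoid.2 lv lvinv.
by rewrite lv_lvinv at1_monoid.1 at1_lv mul1r.
Qed.

Lemma at1_lxi : at1 lxi = 0.
Proof. by rewrite /lxi rmorphB /= at1_lv at1_lvinv subrr. Qed.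

Lemma vpoly_mulI p (a : laurent) : p != 0 -> vpoly p * a = 0 -> a = 0.
Proof.
move=> p0 /(congr1 val); rewrite rmorphM /= val_vpoly => /eqP.
rewrite mulf_eq0 tofrac_eq0 (negPf p0) /= => /eqP a0.
by apply: val_inj; exact: a0.
Qed.

(** Independence of a finite family can be tested at v = 1. In a relation with
    polynomial coefficients these all vanish at 1; they may then be divided by
    v - 1, and the sizes decrease. *)
Lemma lifting_independence (I : eqType) (s : seq I) (F : Type)
    (phi : F -> I -> laurent) :
    (forall g : I -> int, (forall t, \sum_(i <- s) g i * at1 (phi t i) = 0) ->
       {in s, forall i, g i = 0}) ->
  forall g : I -> laurent, (forall t, \sum_(i <- s) g i * phi t i = 0) ->
    {in s, forall i, g i = 0}.
Proof.
move=> ind1.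
have key n : forall p : I -> {poly int}, (forall i, size (p i) <= n)%N ->
    (forall t, \sum_(i <- s) vpoly (p i) * phi t i = 0) -> {in s, forall i, p i = 0}.
  elim: n => [|n IH] p sp rel i si.
    by apply/eqP; rewrite -size_poly_eq0 -leqn0.
  have p1 : {in s, forall i, (p i).[1] = 0}.
    apply: ind1 => t; have := congr1 at1 (rel t); rewrite rmorph_sum raddf0 /= => e.
    rewrite -[RHS]e.
    by apply: eq_bigr => j _; rewrite rmorphM /= at1_vpoly.
  have qex j : exists r, if j \in s then p j = ('X - 1%:P) * r else r = 0.
    case: (boolP (j \in s)) => sj; last by exists 0.
    have /factor_theorem[r pr] : root (p j) 1 by apply/rootP/p1.
    by exists r; rewrite pr mulrC.
  pose q j := projT1 (cid (qex j)).
  have qP j : if j \in s then p j = ('X - 1%:P) * q j else q j = 0.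
    exact: (projT2 (cid (qex j))).
  have pq j : j \in s -> p j = ('X - 1%:P) * q j by move=> sj; have := qP j; rewrite sj.
  have X1 : ('X - 1%:P : {poly int}) != 0 by rewrite polyXsubC_eq0.
  rewrite pq // (IH q) ?mulr0 // => [j|t].
    case: (boolP (j \in s)) => sj; last first.
      by have := qP j; rewrite (negPf sj) => ->; rewrite size_poly0.
    have [->|qj] := eqVneq (q j) 0; first by rewrite size_poly0.
    by have := sp j; rewrite pq // size_mul // size_XsubC.
  apply: (vpoly_mulI X1); rewrite big_distrr -[RHS](rel t) /= big_seq [RHS]big_seq.
  by apply: eq_bigr => j sj; rewrite [in RHS]pq // vpolyM mulrA.
move=> g rel i si.
pose pn j := projT1 (cid (laurent_form (g j))).
have gE j : g j = vpoly (pn j).1 * lvinv ^+ (pn j).2 by exact: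
    (projT2 (cid (laurent_form (g j)))).
pose M := \max_(j <- s) (pn j).2.
pose p j := if j \in s then (pn j).1 * 'X^(M - (pn j).2) else 0.
have pE j : j \in s -> vpoly (p j) = g j * lv ^+ M.
  move=> sj; rewrite /p sj gE vpolyM vpolyXn.
  have hM : ((pn j).2 <= M)%N by rewrite /M; apply: leq_bigmax_seq.
  by rewrite -{2}(subnKC hM) exprD -mulrA (mulrA (lvinv ^+ _)) lvinvK mul1r.
have p0 : {in s, forall i, p i = 0}.
  apply: (key (\max_(j <- s) size (p j))%N) => [j|t].
    case: (boolP (j \in s)) => sj; last by rewrite /p (negPf sj) size_poly0.
    by apply: (leq_bigmax_seq (F := fun j => size (p j))).
  transitivity (lv ^+ M * \sum_(j <- s) g j * phi t j); last by rewrite rel mulr0.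
  rewrite big_distrr [LHS]big_seq [RHS]big_seq; apply: eq_bigr => j sj.
  by rewrite (pE j sj) mulrAC mulrC.
have /esym := pE i si; rewrite p0 // -[0]/(0%:P) vpolyC => h.
by rewrite -[g i]mulr1 -(lvinvK M) mulrCA h mulr0.
Qed.

(** After multiplication by v^d, a polynomial of degree d in v - 1/v becomes the
    combination of the v^(d - i) (v^2 - 1)^i with the same coefficients, and only
    the term i = d has degree 2d. *)
Lemma lxi_transcendental (p : {poly int}) : (map_poly intr p).[lxi] = 0 :> laurent ->
    p = 0.
Proof.
move=> h; apply/eqP; apply: contraT => p0.
pose d := (size p).-1.
have sp : size p = d.+1 by rewrite prednK // lt0n size_poly_eq0.
pose B : {poly int} := 'X^2 - 1%:P.
pose Q : {poly int} := \sum_(i < d.+1) (p`_i)%:P * ('X^(d - i) * B ^+ i).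
have vB : vpoly B = lv * lxi.
  by rewrite /B vpolyB vpolyXn vpolyC /lxi mulrBr lv_lvinv.
have vBX i : vpoly (B ^+ i) = lv ^+ i * lxi ^+ i.
  by rewrite -exprMn -vB /vpoly rmorphXn horner_exp.
have Q0 : Q = 0.
  apply: vpoly_inj; rewrite -[in RHS](mul0r 0) vpolyM -[0]/(0%:P) vpolyC mul0r.
  transitivity (lv ^+ d * (map_poly intr p).[lxi]); last by rewrite h mulr0.
  rewrite /map_poly horner_poly sp /Q /vpoly rmorph_sum horner_sum big_distrr.
  apply: eq_bigr => i _ /=; rewrite -/(vpoly _) vpolyM vpolyC vpolyM vpolyXn vBX.
  have hi : (i <= d)%N by rewrite -ltnS.
  have -> : lv ^+ d = lv ^+ (d - i) * lv ^+ i by rewrite -exprD subnK.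
  by move: (lv ^+ (d - i)) (lv ^+ i) (lxi ^+ i) (_%:~R) => a b a' b'; ring.
have sB i : size (B ^+ i) = (i + i).+1.
  have B0 : B \is monic by exact: monicXnsubC.
  have := size_exp B i; rewrite size_XnsubC //= => e.
  by rewrite -(prednK (n := size _)) ?e ?mul2n ?addnn // size_poly_gt0 monic_neq0
      ?monic_exp.
have := congr1 (fun q : {poly int} => q`_(d + d)) Q0.
rewrite coef_sum coef0 big_ord_recr /= big1 => [|i _].
  rewrite add0r subnn expr0 mul1r coefCM.
  have -> : (B ^+ d)`_(d + d) = 1.
    have /monicP : B ^+ d \is monic by rewrite monic_exp ?monicXnsubC.
    by rewrite /lead_coef sB.
  by rewrite mulr1 => pd; move: p0; rewrite -lead_coef_eq0 /lead_coef -/d pd eqxx.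
rewrite coefCM [X in _ * X]nth_default ?mulr0 //.
apply: leq_trans (size_polyMleq _ _) _; rewrite size_polyXn sB.
by have := ltn_ord i; lia.
Qed.

(** * The representations at v = 1 *)

Section Classical.
Variable N : nat.
Implicit Types (x : affun N) (i : gen).

Section IntRep.
Variables (q1 : int) (q2 : bool -> int).
Hypothesis qq1 : q1 * q1 = 1.
Hypothesis qq2 : forall e, q2 e * q2 e = 1.
Let rep := @orient_rep N _ 0 q1 q2.

Let qq1' : q1 * q1 = 0 * q1 + 1. Proof. by rewrite mul0r add0r. Qed.
Let qq2' e : q2 e * q2 e = 0 * q2 e + 1. Proof. by rewrite mul0r add0r. Qed.

Lemma orient_rep0_srefl i w f : rep (srefl i * w)%g f = hecke_op 0 q1 q2 i (rep w f).
Proof.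
have := alen_srefl i w; case: ifP => _ Lw; last exact: orient_rep_srefl.
have -> : rep w f = hecke_op 0 q1 q2 i (rep (srefl i * w)%g f) by rewrite
    -orient_rep_srefl // sreflK.
by rewrite hecke_op_quad //; apply/funext => x; rewrite mul0r add0r.
Qed.

Lemma orient_rep0_omega w f : rep (omega * w)%g f = omega_op (rep w f).
Proof. exact: orient_rep_omega. Qed.

Lemma orient_rep0_one f : rep 1%g f = f.
Proof. exact: orient_rep_one. Qed.

(** Since xi = 0 the generators become involutions, and the representation of the
    Hecke algebra becomes one of the group. *)
Lemma orient_rep0_mul w w' f : rep (w * w')%g f = rep w (rep w' f).
Proof.
elim/affW_ind: w => [|w IH|i w IH _]; first by rewrite mul1g orient_rep0_one.
  by rewrite -mulgA !orient_rep0_omega IH.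
by rewrite -mulgA !orient_rep0_srefl IH.
Qed.

Lemma twisted_trace0_conj (B : seq (affun N)) m c w y : uniq B ->
    (forall i, {in B, forall x, flip i x \in B}) ->
    {in B, forall x, flip_omega x \in B} -> {in B, forall x, shift m c x \in B} ->
    (forall e, q2 (e (+) c) = q2 e) ->
  twisted_trace 0 q1 q2 B m c (w ^ y)%g = twisted_trace 0 q1 q2 B m c w.
Proof.
move=> uB fB oB sB qc.
have E a b : twisted_trace 0 q1 q2 B m c (a * b)%g =
    twisted_trace 0 q1 q2 B m c (b * a)%g.
  have mulE a' b' : twisted_trace 0 q1 q2 B m c (a' * b')%g =
      optrace B (rep a' \o rep b' \o shift_op m c).
    by rewrite /twisted_trace; congr optrace; apply/funext => f /=;
        rewrite -orient_rep0_mul.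
  by rewrite !mulE; apply: twisted_trace_comm.
by rewrite conjgE E -mulgA mulgV mulg1.
Qed.
End IntRep.

Lemma twisted_trace_at1 q1 q2 (B : seq (affun N)) m c w :
  at1 (twisted_trace lxi q1 q2 B m c w) = twisted_trace 0 (at1 q1) (at1 \o q2) B m c w.
Proof.
rewrite /twisted_trace /optrace rmorph_sum /=; apply: eq_bigr => x _.
rewrite -at1_lxi -[LHS]/((at1 \o orient_rep lxi q1 q2 w (shift_op m c (dirac _ x)))
    x) -orient_rep_rmorph.
congr (orient_rep _ _ _ _ _ x); apply/funext => y /=.
by rewrite /shift_op /dirac /=; case: (_ == _); rewrite ?rmorph1 ?rmorph0.
Qed.

(** The right action of the group on affine functionals by composition. *)
Definition pullback (w : affW) x : affun N := let: (h, k, n, e) := x in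
  let l := (val w).1 in let u := (val w).2 in
  (h * u 0 0 + k * u 1 0, h * u 0 1 + k * u 1 1,
   n + (h * l 0 0 + k * l 1 0)%:~R, e (+) parity w).

Lemma val_mul_coord (a b : affW) :
  (((val (a * b)%g).1 0 0 = (val a).1 0 0 +
      ((val a).2 0 0 * (val b).1 0 0 + (val a).2 0 1 * (val b).1 1 0)) *
  ((val (a * b)%g).1 1 0 = (val a).1 1 0 +
      ((val a).2 1 0 * (val b).1 0 0 + (val a).2 1 1 * (val b).1 1 0))) *
  (((val (a * b)%g).2 0 0 = (val a).2 0 0 * (val b).2 0 0 + (val a).2 0 1 *
      (val b).2 1 0) *
  ((val (a * b)%g).2 0 1 = (val a).2 0 0 * (val b).2 0 1 + (val a).2 0 1 *
      (val b).2 1 1) *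
  ((val (a * b)%g).2 1 0 = (val a).2 1 0 * (val b).2 0 0 + (val a).2 1 1 *
      (val b).2 1 0) *
  ((val (a * b)%g).2 1 1 = (val a).2 1 0 * (val b).2 0 1 + (val a).2 1 1 *
      (val b).2 1 1)).
Proof. by rewrite val_mul /= -mulmxE !mxE !sum2. Qed.

Lemma pullback_mul w w' x : pullback (w * w')%g x = pullback w' (pullback w x).
Proof.
case: x => [[[h k] n] e]; rewrite /pullback parity_mul !val_mul_coord.
by apply: affun_eq; rewrite ?addbA //; ring.
Qed.

Lemma pullback_srefl i x : pullback (srefl i) x = flip i x.
Proof.
case: x => [[[h k] n] e]; rewrite /pullback parity_srefl val_srefl.
by case: i => /=; rewrite !vec2E !mat2E; apply: affun_eq; rewrite ?addbF //; ring.
Qed.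

Lemma pullback_omega x : pullback omega x = flip_omega x.
Proof.
case: x => [[[h k] n] e]; rewrite /pullback parity_omega val_omega /= !vec2E !mat2E.
by apply: affun_eq; rewrite ?addbT //; ring.
Qed.

Lemma pullback_one x : pullback 1%g x = x.
Proof.
case: x => [[[h k] n] e]; rewrite /pullback parity_one val_one /= !vec2E !mat2E.
by apply: affun_eq; rewrite ?addbF //; ring.
Qed.

Lemma shift_pullback m c w x : shift m c (pullback w x) = pullback w (shift m c x).
Proof.
case: x => [[[h k] n] e]; rewrite /pullback /shift.
by apply: affun_eq => //; [ring | rewrite addbAC].
Qed.

Lemma flip_fix i x : wall i x = 0 -> flip i x = x.
Proof.
case: x => [[[h k] n] e]; case: i => /= hw; apply: affun_eq => //; try lia.
by rewrite (_ : h = 0) ?addr0 //; lia.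
Qed.

Lemma orient_rep_classical w (f : affun N -> int) x :
    orient_rep 0 1 (fun=> 1) w f x = f (pullback w x).
Proof.
have hE i (g : affun N -> int) y : hecke_op 0 1 (fun=> 1) i g y = g (flip i y).
  rewrite /hecke_op /refl_op; case: eqP => [/flip_fix->|_].
    by rewrite (_ : fixed_scalar _ _ _ _ = 1) ?mul1r //; case: (i).
  by case: ifP => _; rewrite mul0r addr0.
elim/affW_ind: w x => [|w IH|i w IH _] x;
    first by rewrite orient_rep0_one // pullback_one.
  by rewrite orient_rep0_omega // /omega_op /= IH pullback_mul pullback_omega.
by rewrite orient_rep0_srefl // hE IH pullback_mul pullback_srefl.
Qed.

(** At v = 1 with trivial scalars, the representation permutes the functionals, and
    the twisted trace counts those on which [w] acts as a given shift. *)
Lemma twisted_trace_classical (B : seq (affun N)) m c w :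
  twisted_trace 0 1 (fun=> 1) B m c w = (count
      (fun x => shift m c (pullback w x) == x) B)%:Z.
Proof.
rewrite /twisted_trace /optrace -sum1_count -[RHS]natz natr_sum [RHS]big_mkcond.
apply: eq_bigr => x _; rewrite /= orient_rep_classical /shift_op /dirac /=.
by case: (_ == _).
Qed.
End Classical.

Definition weyl_orbit (a b : int) : seq (int * int) :=
  [:: (a, b); (2 * b - a, b); (a, a - b); (2 * b - a, b - a); (a - 2 * b, a - b);
      (- a, b - a); (a - 2 * b, - b); (- a, - b)].

(** Reduced words for the eight elements of W, listed in the order of
    [weyl_orbit]. *)
Definition weyl_words : seq (seq gen) :=
  [:: [::]; [:: G1]; [:: G2]; [:: G1; G2]; [:: G2; G1]; [:: G1; G2; G1];
      [:: G2; G1; G2]; [:: G1; G2; G1; G2]].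

Lemma weyl_orbitP N a b h k (n : 'Z_N) e : (h, k) \in weyl_orbit a b ->
  exists2 i, (i < 8)%N & pullback (word_elt (nth [::] weyl_words i)) (a, b, n, e) =
      (h, k, n, e).
Proof.
have ws gs : pullback (word_elt gs) (a, b, n, e) =
    foldl (fun x i => flip i x) (a, b, n, e) gs.
  elim: gs (a, b, n, e) => [|i gs IH] x /=; first by rewrite pullback_one.
  by rewrite pullback_mul pullback_srefl IH.
rewrite !inE => H.
repeat (case/orP: H => [/eqP[-> ->]|H]); last move/eqP: H => [-> ->].
- by exists 0%N => //; rewrite ws.
- by exists 1%N => //; rewrite ws.
- by exists 2%N => //; rewrite ws.
- by exists 3%N => //; rewrite ws; apply: affun_eq => //; ring.
- by exists 4%N => //; rewrite ws; apply: affun_eq => //; ring.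
- by exists 5%N => //; rewrite ws; apply: affun_eq => //; ring.
- by exists 6%N => //; rewrite ws; apply: affun_eq => //; ring.
- by exists 7%N => //; rewrite ws; apply: affun_eq => //; ring.
Qed.

Lemma weyl_orbit_closed a b h k : (h, k) \in weyl_orbit a b ->
  ((2 * k - h, k) \in weyl_orbit a b) && ((h, h - k) \in weyl_orbit a b).
Proof.
have E (x y x' y' : int) : x = x' -> y = y' -> (x, y) == (x', y').
  by move=> -> ->.
rewrite {1}/weyl_orbit !inE => H.
repeat (case/orP: H => [/eqP[-> ->]|H]); last move/eqP: H => [-> ->].
all: apply/andP; split;
  repeat first [by apply: E; ring | by apply/orP; left; apply: E; ring | apply/orP;
      right].
Qed.

Lemma weyl_orbit_s1 a b h k : (h, k) \in weyl_orbit a b ->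
    (2 * k - h, k) \in weyl_orbit a b.
Proof. by case/weyl_orbit_closed/andP. Qed.

Lemma weyl_orbit_s2 a b h k : (h, k) \in weyl_orbit a b ->
    (h, h - k) \in weyl_orbit a b.
Proof. by case/weyl_orbit_closed/andP. Qed.

Section OrbitPoints.
Variables (N : nat) (a b : int).

Definition orbit_affuns : seq (affun N) :=
  [seq (p.1, p.2, q.1, q.2) | p <- undup (weyl_orbit a b), q <- enum {: 'Z_N * bool}].

Lemma mem_orbit_affuns (h k : int) (n : 'Z_N) e : ((h, k, n, e) \in orbit_affuns) =
    ((h, k) \in weyl_orbit a b).
Proof.
apply/allpairsP/idP => [[[[p1 p2] [r1 r2]] [/= hp _ [-> -> _ _]]]|hh].
  by rewrite -mem_undup.
by exists ((h, k), (n, e)); rewrite mem_undup mem_enum.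
Qed.

Lemma orbit_affuns_uniq : uniq orbit_affuns.
Proof.
apply: allpairs_uniq; rewrite ?undup_uniq ?enum_uniq //.
by move=> [[p1 p2] [r1 r2]] [[p1' p2'] [r1' r2']] _ _ /= [-> -> -> ->].
Qed.

Lemma orbit_affuns_flip i : {in orbit_affuns, forall x, flip i x \in orbit_affuns}.
Proof.
move=> [[[h k] n] e]; case: i; rewrite !mem_orbit_affuns => hh.
- have -> : (- h, k - h) = (2 * (2 * k - h - k) - (2 * k - h), 2 * k - h - k).
    by congr pair; ring.
  exact: weyl_orbit_s1 (weyl_orbit_s2 (weyl_orbit_s1 hh)).
- exact: weyl_orbit_s1.
- exact: weyl_orbit_s2.
Qed.

Lemma orbit_affuns_omega : {in orbit_affuns, forall x, flip_omega x \in orbit_affuns}.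
Proof.
move=> [[[h k] n] e]; rewrite !mem_orbit_affuns => hh.
have -> : (h - 2 * k, - k) = (2 * (h - k) - h, 2 * (h - k) - h - (h - k)).
  by congr pair; ring.
exact: weyl_orbit_s2 (weyl_orbit_s1 (weyl_orbit_s2 hh)).
Qed.

Lemma orbit_affuns_shift m c : {in orbit_affuns, forall x,
    shift m c x \in orbit_affuns}.
Proof. by move=> [[[h k] n] e]; rewrite !mem_orbit_affuns. Qed.

Lemma orbit_affuns_base n e : (a, b, n, e) \in orbit_affuns.
Proof. by rewrite mem_orbit_affuns inE eqxx. Qed.
End OrbitPoints.

(** * Two families of trace functions *)

Lemma Zp_int_inj N (x y : int) : (1 < N)%N -> (`|x - y| < N)%N ->
  x%:~R = y%:~R :> 'Z_N -> x = y.
Proof.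
move=> N1 hxy /eqP; rewrite -subr_eq0 -intrB => /eqP.
have nat0 n : (n < N)%N -> (n%:R = 0 :> 'Z_N) -> n = 0%N.
  by move=> nN /(congr1 val) /=; rewrite val_Zp_nat // modn_small.
case ez: (x - y) hxy => [n|n] hn h.
  by apply/eqP; rewrite -subr_eq0 ez (nat0 n).
have /nat0 : (n.+1)%:R = 0 :> 'Z_N.
  by apply: oppr_inj; rewrite oppr0 -[RHS]h NegzE mulrNz.
by move/(_ hn).
Qed.

Lemma qq_lv : lv * lv = lxi * lv + 1.
Proof. by rewrite /lxi mulrBl (mulrC lvinv) lv_lvinv subrK. Qed.

Lemma qq_lvinv : (- lvinv) * (- lvinv) = lxi * (- lvinv) + 1.
Proof. by rewrite mulrNN /lxi mulrN mulrBl lv_lvinv opprB subrK. Qed.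

Section OrbitTrace.
Variables (a b : int) (N : nat) (l : int) (c : bool).

(** The trace attached to the orbit of the linear functional (a, b), counting at v = 1
    the functionals in the orbit to which [w] adds the constant l, for w of
    parity c. *)
Definition orbit_trace : affW -> laurent :=
  twisted_trace lxi lv (fun=> lv) (orbit_affuns N a b) (- l%:~R) c.

Definition fixes (w : affW) := [/\
  a * (val w).2 0 0 + b * (val w).2 1 0 = a,
  a * (val w).2 0 1 + b * (val w).2 1 1 = b,
  (a * (val w).1 0 0 + b * (val w).1 1 0)%:~R = l%:~R :> 'Z_N & parity w = c].

Lemma orbit_trace_like (H : algType laurent) (T : affW -> H) (hT : is_hecke_algebra T) :
  trace_like hT orbit_trace.
Proof.
apply: twisted_trace_trace_like; [exact: qq_lv | by move=> _; exact: qq_lv |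
  exact: orbit_affuns_uniq | exact: orbit_affuns_flip | exact: orbit_affuns_omega |
  exact: orbit_affuns_shift | by []].
Qed.

Lemma orbit_trace_at1E w : at1 (orbit_trace w) =
  (count (fun x => shift (- l%:~R) c (pullback w x) == x) (orbit_affuns N a b))%:Z.
Proof.
rewrite /orbit_trace twisted_trace_at1 at1_lv -twisted_trace_classical;
    congr twisted_trace.
by apply/funext => e /=; rewrite at1_lv.
Qed.

Lemma fixesP n e w :
  (shift (- l%:~R) c (pullback w (a, b, n, e)) = (a, b, n, e) :> affun N) <-> fixes w.
Proof.
rewrite /pullback /shift; split=> [[h1 h2 h3 h4]|[h1 h2 h3 h4]]; last first.
  by rewrite h1 h2 h3 h4; apply: affun_eq => //; rewrite ?addrK ?addbK.
split=> //.
  by apply/eqP; rewrite -subr_eq0; apply/eqP/(addrI n); rewrite addr0 addrA.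
by move: h4; case: (parity w); case: c; case: e {h3}.
Qed.

Lemma fixes_trace_neq0 w : fixes w -> at1 (orbit_trace w) != 0.
Proof.
move=> fw; rewrite orbit_trace_at1E.
rewrite eqz_nat -lt0n -has_count; apply/hasP.
by exists (a, b, 0, false); [exact: orbit_affuns_base | apply/eqP/fixesP].
Qed.

(** A functional in the orbit is the image of (a, b) under an element of W; conjugating
    by this element moves the fixed functional to (a, b). Only these eight
    conjugations are needed, which keeps the translation parts bounded. *)
Lemma trace_neq0_fixes w : at1 (orbit_trace w) != 0 ->
  exists2 i, (i < 8)%N & fixes (w ^ (word_elt (nth [::] weyl_words i))^-1)%g.
Proof.
rewrite orbit_trace_at1E eqz_nat -lt0n -has_count => /hasP[[[[h k] n] e]].
rewrite mem_orbit_affuns => /(weyl_orbitP n e) [i i8 ew0] /eqP ex; exists i => //.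
set w0 := word_elt _ in ew0 *.
apply/(fixesP n e); rewrite conjgE invgK !pullback_mul ew0
    (shift_pullback _ _ w0^-1%g) ex.
by rewrite -ew0 -pullback_mul mulgV pullback_one.
Qed.

Lemma orbit_trace_conj w z : at1 (orbit_trace (w ^ z)%g) = at1 (orbit_trace w).
Proof.
rewrite !twisted_trace_at1; apply: twisted_trace0_conj; rewrite /= ?at1_lv //.
- exact: orbit_affuns_uniq.
- exact: orbit_affuns_flip.
- exact: orbit_affuns_omega.
- exact: orbit_affuns_shift.
Qed.
End OrbitTrace.

Definition quad_root (b : bool) : laurent := if b then - lvinv else lv.

Lemma quad_rootP b : quad_root b * quad_root b = lxi * quad_root b + 1.
Proof. by case: b; [exact: qq_lvinv | exact: qq_lv]. Qed.

Lemma at1_quad_root b : at1 (quad_root b) = (-1) ^+ b.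
Proof. by case: b; rewrite /quad_root ?rmorphN /= ?at1_lv ?at1_lvinv. Qed.

Section PointTrace.
Variables (b1 b2 b2' c : bool).
Hypothesis cb : c -> b2 = b2'.

Definition zero_affuns : seq (affun 2) := [:: (0, 0, 0, false); (0, 0, 0, true)].
(** The trace on the two functionals with zero linear part, where every generator acts
    by scalars: v or -1/v for s_1 according to b1, and likewise for s_2 on either
    functional according to b2 and b2'. *)
Definition zero_trace : affW -> laurent :=
  twisted_trace lxi (quad_root b1) (fun e => quad_root (if e then b2' else b2))
      zero_affuns 0 c.

Lemma zero_affuns_flip i : {in zero_affuns, forall x, flip i x \in zero_affuns}.
Proof.
by move=> x; rewrite !inE => /orP[] /eqP ->; case: i.
Qed.

Lemma zero_affuns_omega : {in zero_affuns, forall x, flip_omega x \in zero_affuns}.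
Proof. by move=> x; rewrite !inE => /orP[] /eqP ->. Qed.

Lemma zero_affuns_shift : {in zero_affuns, forall x, shift 0 c x \in zero_affuns}.
Proof. by move=> x; rewrite !inE => /orP[] /eqP ->; case: (c). Qed.

Lemma zero_affuns_scalar (e : bool) : quad_root (if e (+) c then b2' else b2) =
    quad_root (if e then b2' else b2).
Proof. by case: c cb => [->|_]; rewrite ?addbF // !if_same. Qed.

Lemma zero_trace_like (H : algType laurent) (T : affW -> H) (hT : is_hecke_algebra T) :
  trace_like hT zero_trace.
Proof.
apply: twisted_trace_trace_like; [exact: quad_rootP | by move=> e; exact:
    quad_rootP | by [] |
  exact: zero_affuns_flip | exact: zero_affuns_omega | exact:
      zero_affuns_shift | exact: zero_affuns_scalar].
Qed.

Lemma zero_trace_conj w z : at1 (zero_trace (w ^ z)%g) = at1 (zero_trace w).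
Proof.
rewrite !twisted_trace_at1; apply: twisted_trace0_conj.
- by rewrite at1_quad_root -expr2 sqrr_sign.
- by move=> e /=; rewrite at1_quad_root -expr2 sqrr_sign.
- by [].
- exact: zero_affuns_flip.
- exact: zero_affuns_omega.
- exact: zero_affuns_shift.
- by move=> e /=; rewrite zero_affuns_scalar.
Qed.

Let e1 := (srefl G1 * (srefl G2 * 1))%g.
Let e2 := (srefl G1 * (srefl G2 * (srefl G1 * (srefl G2 * 1))))%g.
Let e3 := (srefl G0 * (srefl G2 * 1))%g.
Let e4 := (omega * (srefl G1 * 1))%g.
Let e5 := (omega * (srefl G2 * 1))%g.

(** Every wall contains the zero functional, so the generators act by scalars and
    [tau] by exchanging the two functionals. *)
Lemma zero_trace_values :
  [/\ at1 (zero_trace e1) = (~~ c)%:R * ((-1) ^+ b1 * (-1) ^+ b2 + (-1) ^+ b1 *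
      (-1) ^+ b2'),
      at1 (zero_trace e2) = (~~ c)%:R * 2,
      at1 (zero_trace e3) = (~~ c)%:R * (2 * (-1) ^+ b2 * (-1) ^+ b2'),
      at1 (zero_trace e4) = c%:R * (2 * (-1) ^+ b1) &
      at1 (zero_trace e5) = c%:R * ((-1) ^+ b2 + (-1) ^+ b2')].
Proof.
have qq1 : at1 (quad_root b1) * at1 (quad_root b1) =
    1 by rewrite at1_quad_root -expr2 sqrr_sign.
have qq2 e : (at1 \o fun e => quad_root (if e then b2' else b2)) e *
   (at1 \o fun e => quad_root (if e then b2' else b2)) e = 1.
  by rewrite /= at1_quad_root -expr2 sqrr_sign.
have S := (@orient_rep0_srefl 2 _ _ qq1 qq2, @orient_rep0_omega 2 _ _ qq1 qq2,
    @orient_rep0_one 2 _ _ qq1 qq2).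
rewrite /zero_trace !twisted_trace_at1 /twisted_trace /optrace !big_cons !big_nil /=
    /e1 /e2 /e3 /e4 /e5 !S.
rewrite /omega_op /shift_op /hecke_op /refl_op /dirac /= !at1_quad_root.
by case: c cb => [->|_] //; case: b1; case: b2; case: b2'.
Qed.
End PointTrace.

(** * Conjugacy classes *)

Lemma conj_class_eq x y z z' : (x ^ z = y ^ z')%g -> conj_class x = conj_class y.
Proof.
have sub (a b t t' : affW) : (a ^ t = b ^ t')%g -> conj_class a `<=` conj_class b.
  move=> e _ [r _ <-]; exists (t' * (t^-1 * r))%g => //.
  by rewrite conjgM -e -conjgM mulgA mulgV mul1g.
by move=> e; apply/seteqP; split; [apply: sub e | apply: sub (esym e)].
Qed.

Lemma conj_class_of O x : conj_classes O -> O x -> O = conj_class x.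
Proof.
move=> [y _ <-] [z _ e]; apply: (@conj_class_eq _ _ z 1%g).
by rewrite e conjg1.
Qed.

Lemma sreflV i : ((srefl i)^-1 = srefl i)%g.
Proof. by rewrite -[RHS]mulg1 -(mulgV (srefl i)) sreflK. Qed.

Lemma transl_inv nu : ((transl nu)^-1 = transl (- nu))%g.
Proof. by apply: val_inj; rewrite /= invr1 mul1mx. Qed.

Lemma val_conj_transl y nu :
  val (y ^ transl nu)%g = ((val y).1 - nu + (val y).2 *m nu, (val y).2).
Proof.
rewrite conjgE transl_inv !val_mul !val_transl [_.1]/= [_.2]/= mul1mx mul1r mulr1.
by rewrite [(_, _).1]/= addrA (addrC (- nu)).
Qed.

(** Conjugation by a translation moves the translation part by the image of 1 - u. *)
Lemma transl_conj (y x : affW) (m n : int) : (val y).2 = (val x).2 ->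
    (val y).1 0 0 - m + ((val x).2 0 0 * m + (val x).2 0 1 * n) = (val x).1 0 0 ->
    (val y).1 1 0 - n + ((val x).2 1 0 * m + (val x).2 1 1 * n) = (val x).1 1 0 ->
  exists z, (y ^ z)%g = x.
Proof.
move=> uyx h0 h1; exists (transl (vec2 m n)); apply: val_inj.
rewrite val_conj_transl uyx [RHS]surjective_pairing; congr pair.
rewrite [RHS]vec2_eta [LHS]vec2_eta -h0 -h1; move: (val x).2 (val y).1 => u l.
by rewrite !mxE !sum2 !mxE.
Qed.

Lemma val_conj_srefl (y : affW) i : val (y ^ srefl i)%g =
    val (srefl i * (y * srefl i))%g.
Proof. by rewrite conjgE sreflV. Qed.

Lemma refl1_conj (y x : affW) :
  (val y).2 = mat2 (-1) 0 2 1 -> (val x).2 = mat2 (-1) 0 2 1 ->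
  (val y).1 0 0 + (val y).1 1 0 = (val x).1 0 0 + (val x).1 1 0 ->
  parity y = parity x -> exists z, (y ^ z)%g = x.
Proof.
rewrite /parity => uy ux e p.
apply: (@transl_conj _ _ (divz ((val y).1 0 0 - (val x).1 0 0) 2) 0);
  rewrite ?uy ?ux ?mat2E //; lia.
Qed.

Lemma refl2_conj (y x : affW) :
  (val y).2 = mat2 1 1 0 (-1) -> (val x).2 = mat2 1 1 0 (-1) ->
  2 * (val y).1 0 0 + (val y).1 1 0 = 2 * (val x).1 0 0 + (val x).1 1 0 ->
  exists z, (y ^ z)%g = x.
Proof.
move=> uy ux e.
apply: (@transl_conj _ _ 0 ((val x).1 0 0 - (val y).1 0 0));
  rewrite ?uy ?ux ?mat2E //; lia.
Qed.

Lemma val_conj_srefl1 y : val (y ^ srefl G1)%g = 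
  (vec2 (- (val y).1 0 0) (2 * (val y).1 0 0 + (val y).1 1 0), mat2 (-1) 0 2 1 *
      (val y).2 * mat2 (-1) 0 2 1).
Proof.
rewrite val_conj_srefl !val_mul val_srefl [_.1]/= [_.2]/=
    -vec2_0 mulmx0 addr0 add0r mulrA.
by rewrite [(val y).1 in LHS]vec2_eta mat2_vec2; congr (vec2 _ _, _); ring.
Qed.

Lemma val_conj_srefl2 y : val (y ^ srefl G2)%g = 
  (vec2 ((val y).1 0 0 + (val y).1 1 0) (- (val y).1 1 0), mat2 1 1 0 (-1) *
      (val y).2 * mat2 1 1 0 (-1)).
Proof.
rewrite val_conj_srefl !val_mul val_srefl [_.1]/= [_.2]/=
    -vec2_0 mulmx0 addr0 add0r mulrA.
by rewrite [(val y).1 in LHS]vec2_eta mat2_vec2; congr (vec2 _ _, _); ring.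
Qed.

(** Representatives of the elliptic conjugacy classes, whose elements have a linear
    part without nonzero fixed vector. *)
Definition elliptic (i : nat) : affW :=
  nth 1%g [:: srefl G1 * (srefl G2 * 1); srefl G1 *
      (srefl G2 * (srefl G1 * (srefl G2 * 1)));
    srefl G0 * (srefl G2 * 1); omega * (srefl G1 * 1); omega * (srefl G2 * 1)]%g i.

Inductive conj_type (y : affW) : Prop :=
| ConjTransl of (val y).2 = mat2 1 0 0 1
| ConjRefl1 z of (val (y ^ z)%g).2 = mat2 (-1) 0 2 1
| ConjRefl2 z of (val (y ^ z)%g).2 = mat2 1 1 0 (-1)
| ConjEll z i of (i < 5)%N & (y ^ z)%g = elliptic i.

Lemma val_elliptic : [/\ val (elliptic 0%N) = (vec2 0 0, mat2 (-1) (-1) 2 1),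
   val (elliptic 1%N) = (vec2 0 0, mat2 (-1) 0 0 (-1)),
   val (elliptic 2%N) = (vec2 1 0, mat2 (-1) 0 0 (-1)),
   val (elliptic 3%N) = (vec2 0 1, mat2 (-1) 0 0 (-1)) &
   val (elliptic 4%N) = (vec2 0 1, mat2 1 1 (-2) (-1))].
Proof.
by split; rewrite /elliptic [nth _ _ _]/=
    !mulg1 !val_mul ?val_omega !val_srefl [_.1]/= [_.2]/= !affE.
Qed.

(** The linear part is trivial, a reflection, or a rotation u without fixed vector. In
    the last case the translation part matters only modulo the image of 1 - u,
    which has index two or four. *)
Lemma conj_typeP y : conj_type y.
Proof.
have [v0 v1 v2 v3 v4] := val_elliptic.
pose C (x : affW) := exists z i, (i < 5)%N /\ (x ^ z)%g = elliptic i.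
have Cy : C y -> conj_type y by case=> z [i [i5]]; apply: ConjEll.
have via (x t : affW) : C (x ^ t)%g -> C x.
  by case=> z [i [i5 e]]; exists (t * z)%g, i; rewrite conjgM.
have ellP (x : affW) i (i5 : (i < 5)%N) m n : (val x).2 = (val (elliptic i)).2 ->
    (val x).1 0 0 - m + ((val (elliptic i)).2 0 0 * m + (val (elliptic i)).2 0 1 * n)
        = (val (elliptic i)).1 0 0 ->
    (val x).1 1 0 - n + ((val (elliptic i)).2 1 0 * m + (val (elliptic i)).2 1 1 * n)
        = (val (elliptic i)).1 1 0 ->
    C x.
  by move=> h1 h2 h3; have [z e] := transl_conj h1 h2 h3; exists z, i.
have rot (x : affW) : (val x).2 = mat2 (-1) (-1) 2 1 -> ~~ parity x -> C x.
  rewrite /parity => ux px.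
  apply: (@ellP x 0%N isT (- divz ((val x).1 1 0) 2) ((val x).1 0 0 + (val x).1 1 0));
    rewrite v0 ?vec2E ?mat2E //; lia.
have rot' (x : affW) : (val x).2 = mat2 1 1 (-2) (-1) -> parity x -> C x.
  rewrite /parity => ux px.
  apply: (@ellP x 4%N isT (divz ((val x).1 1 0 - 1) 2 + (val x).1 0 0)
      (- (val x).1 0 0));
    rewrite v4 ?vec2E ?mat2E //; lia.
have parityJ (x t : affW) : parity (x ^ t)%g = parity x.
  have : parity (t^-1 * t)%g = false by rewrite mulVg parity_one.
  by rewrite conjgE !parity_mul; case: (parity x); case: (parity t); case: (parity _).
have neg (x : affW) : (val x).2 = mat2 (-1) 0 0 (-1) -> C x.
  move=> ux; case px: (modz ((val x).1 1 0) 2 == 1); case ev0: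
      (modz ((val x).1 0 0) 2 == 0).
  - apply: (@ellP x 3%N isT (divz ((val x).1 0 0) 2) (divz ((val x).1 1 0 - 1) 2));
      rewrite v3 ?vec2E ?mat2E //; lia.
  - apply: (via _ (srefl G2)).
    apply: (@ellP _ 3%N isT (divz ((val x).1 0 0 + (val x).1 1 0) 2)
        (divz (- (val x).1 1 0 - 1) 2));
      rewrite val_conj_srefl2 v3 ?vec2E ?mat2E ?ux ?mat2M //; lia.
  - apply: (@ellP x 1%N isT (divz ((val x).1 0 0) 2) (divz ((val x).1 1 0) 2));
      rewrite v1 ?vec2E ?mat2E //; lia.
  - apply: (@ellP x 2%N isT (divz ((val x).1 0 0 - 1) 2) (divz ((val x).1 1 0) 2));
      rewrite v2 ?vec2E ?mat2E //; lia.
have := weyl_enum (valP y); rewrite !inE => H.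
case/orP: H => [/eqP uy|H]; first exact: ConjTransl.
case/orP: H => [/eqP uy|H]; first by apply: (@ConjRefl1 _ 1%g); rewrite conjg1.
case/orP: H => [/eqP uy|H]; first by apply: (@ConjRefl2 _ 1%g); rewrite conjg1.
case/orP: H => [/eqP uy|H].
  apply: Cy; case py: (parity y); last by apply: rot; rewrite ?py.
  by apply: (via _ (srefl G1)); apply: rot'; rewrite ?parityJ // val_conj_srefl1 /=
      uy !mat2M.
case/orP: H => [/eqP uy|H].
  apply: Cy; case py: (parity y); first by apply: rot'; rewrite ?py.
  by apply: (via _ (srefl G1)); apply: rot;
      rewrite ?parityJ ?py // val_conj_srefl1 /= uy !mat2M.
case/orP: H => [/eqP uy|H].
  by apply: (@ConjRefl2 _ (srefl G1)); rewrite val_conj_srefl1 /= uy !mat2M.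
case/orP: H => [/eqP uy|/eqP uy].
  by apply: (@ConjRefl1 _ (srefl G2)); rewrite val_conj_srefl2 /= uy !mat2M.
by apply: Cy; apply: neg.
Qed.

(** * Separation of conjugacy classes at v = 1 *)

Lemma affW_eq (x y : affW) : (val x).1 0 0 = (val y).1 0 0 ->
  (val x).1 1 0 = (val y).1 1 0 -> (val x).2 = (val y).2 -> x = y.
Proof.
move=> h0 h1 h2; apply: val_inj; rewrite [LHS]surjective_pairing
    [RHS]surjective_pairing.
by rewrite h2 [(val x).1]vec2_eta h0 h1 -vec2_eta.
Qed.

Section Separation.
Variables (H : algType laurent) (T : affW -> H) (hT : is_hecke_algebra T).
Variables (s : seq (set affW)) (rep : set affW -> affW) (g : set affW -> int).
Hypothesis us : uniq s.
Hypothesis hs : {in s, forall O, conj_classes O}.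
Hypothesis hrep : {in s, forall O, O (rep O)}.

Definition annihilates (psi : affW -> int) := \sum_(O <- s) g O * psi (rep O) = 0.
Hypothesis rel : forall phi, trace_like hT phi -> annihilates (fun w => at1 (phi w)).

Lemma annihilates_add psi psi' : annihilates psi -> annihilates psi' ->
    annihilates (fun w => psi w + psi' w).
Proof.
rewrite /annihilates => h h'; under eq_bigr do rewrite mulrDr.
by rewrite big_split /= h h' addr0.
Qed.

Lemma annihilates_sub psi psi' : annihilates psi -> annihilates psi' ->
    annihilates (fun w => psi w - psi' w).
Proof.
rewrite /annihilates => h h'; under eq_bigr do rewrite mulrBr.
by rewrite sumrB h h' subr0.
Qed.

Lemma rep_conj_eq O O' z z' : O \in s -> O' \in s ->
  (rep O ^ z = rep O' ^ z')%g -> O = O'.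
Proof.
move=> sO sO' e.
rewrite (conj_class_of (hs sO) (hrep sO))
    (conj_class_of (hs sO') (hrep sO')).
exact: conj_class_eq e.
Qed.

(** This is how classes are discarded one after the other: [psi] has to vanish only on
    those of the other classes that have not been discarded before. *)
Lemma isolate psi O1 : annihilates psi -> O1 \in s -> psi (rep O1) != 0 ->
  (forall O, O \in s -> g O != 0 -> psi (rep O) != 0 -> O = O1) -> g O1 = 0.
Proof.
move=> nl s1 p1 h; move: nl; rewrite /annihilates (bigD1_seq O1) //= big_seq_cond big1.
  by rewrite addr0 => /eqP; rewrite mulf_eq0 (negPf p1) orbF => /eqP.
move=> O /andP[sO nO]; apply/eqP; rewrite mulf_eq0.
case: (eqVneq (g O) 0) => //= gO; case: (eqVneq (psi (rep O)) 0) => //= pO.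
by rewrite (h O) ?eqxx in nO.
Qed.

Definition transl_size (w : affW) : nat :=
    addn (absz ((val w).1 0 0)) (absz ((val w).1 1 0)).
Definition weyl_conj (O : set affW) (i : nat) : affW :=
  (rep O ^ (word_elt (nth [::] weyl_words i))^-1)%g.
(** A bound for the translation parts that can be met; the modulus N is chosen above
    it, so that congruences modulo N become equalities. *)
Definition size_bound : nat := \max_(O <- s) \max_(i < 8) transl_size (weyl_conj O i).

Lemma transl_size_bound O i : O \in s -> (i < 8)%N ->
    (transl_size (weyl_conj O i) <= size_bound)%N.
Proof.
move=> sO i8; apply: leq_trans (leq_bigmax_seq _ sO isT).
exact: (leq_bigmax (F := fun i : 'I_8 => transl_size (weyl_conj O i)) (Ordinal i8)).
Qed.

Lemma isolate_orbit a b N l c O1 : O1 \in s ->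
    (exists z, fixes a b N l c (rep O1 ^ z)%g) ->
    (forall O i, O \in s -> g O != 0 -> (transl_size (weyl_conj O i) <= size_bound)%N ->
      fixes a b N l c (weyl_conj O i) -> exists z z',
          (weyl_conj O i ^ z = rep O1 ^ z')%g) ->
  g O1 = 0.
Proof.
move=> s1 [z fz] h.
apply: (isolate (rel (orbit_trace_like a b N l c hT))) => //.
  by rewrite -(orbit_trace_conj _ _ _ _ _ _ z); apply: fixes_trace_neq0.
move=> O sO gO /trace_neq0_fixes [i i8 fi].
have [t [t' e]] := h O i sO gO (transl_size_bound sO i8) fi.
by move: e; rewrite /weyl_conj -conjgM; apply: rep_conj_eq.
Qed.

(** The functional (1, K) is regular, hence fixed by no linear part other than 1, and
    for K large it takes different values on all the translations that occur. *)
Lemma separate_transl O1 : O1 \in s -> (val (rep O1)).2 = mat2 1 0 0 1 -> g O1 = 0.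
Proof.
move=> s1 u1; set x := rep O1 in u1 *.
pose M := maxn size_bound (transl_size x).
(* |l0 - m0| <= 2M < K makes l0 + K l1 determine (l0, l1), and these values
   differ by at most 2M (1 + K) < N. *)
pose K : int := (2 * M + 3)%N.
pose N := (2 * M * (2 * M + 4) + 2)%N.
pose l := (val x).1 0 0 + K * (val x).1 1 0.
apply: (@isolate_orbit 1 K N l (parity x)) => //.
  by exists 1%g; rewrite conjg1 -/x; split; rewrite ?u1 ?mat2E ?mul1r //; ring.
move=> O i sO gO; set y := weyl_conj O i => hy [f0 f1 f2 f3].
exists 1%g, 1%g; rewrite !conjg1 -/x.
have uy : (val y).2 = mat2 1 0 0 1.
  move: f0 f1; rewrite /K; pattern (val y).2; apply: linear_part_ind;
      rewrite !mat2E //; lia.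
have hx : (transl_size x <= M)%N by rewrite leq_maxr.
have {}hy : (transl_size y <= M)%N by rewrite (leq_trans hy) ?leq_maxl.
have {f2} : 1 * (val y).1 0 0 + K * (val y).1 1 0 = l.
  apply: Zp_int_inj f2; first by rewrite /N addn2.
  move: hx hy; rewrite /l /transl_size /K /N.
  move: ((val x).1 0 0) ((val x).1 1 0) ((val y).1 0 0) ((val y).1 1 0) => a b c d.
  nia.
move: hx hy; rewrite /l /transl_size /K mul1r => hx hy e.
have e1 : (val y).1 1 0 = (val x).1 1 0.
  by move: hx hy e; move: ((val x).1 0 0) ((val x).1 1 0) ((val y).1 0 0)
      ((val y).1 1 0) => a b c d; nia.
by apply: affW_eq; rewrite ?uy ?u1 ?e1 //; move: e; rewrite e1 => /addIr.
Qed.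

Lemma linear_part_conj1 (w t : affW) : (val (w ^ t)%g).2 = mat2 1 0 0 1 ->
    (val w).2 = mat2 1 0 0 1.
Proof.
have J (w' t' : affW) : (val w').2 = 1 -> (val (w' ^ t')%g).2 = 1.
  have e : (val (t'^-1 * t')%g).2 = 1 by rewrite mulVg.
  by move=> uw; rewrite conjgE !val_mul [_.2]/= uw mul1r -[RHS]e.
by rewrite -mat2_1 => /(J _ t^-1%g); rewrite -conjgM mulgV conjg1.
Qed.

Lemma vanishing_transl O t : O \in s -> (val (rep O ^ t)%g).2 = mat2 1 0 0 1 -> g O = 0.
Proof. by move=> sO /linear_part_conj1; apply: separate_transl. Qed.

(** The functional (1, 1) is fixed only by 1 and by s_1. The classes of translations
    have already been discarded, and its value together with the parity
    determines the class of an element with linear part s_1. *)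
Lemma separate_refl1 O1 z : O1 \in s -> (val (rep O1 ^ z)%g).2 = mat2 (-1) 0 2 1 ->
    g O1 = 0.
Proof.
move=> s1; set x := (rep O1 ^ z)%g => u1.
pose N := (size_bound + transl_size x + 2)%N.
pose l := (val x).1 0 0 + (val x).1 1 0.
apply: (@isolate_orbit 1 1 N l (parity x)) => //.
  by exists z; rewrite -/x; split; rewrite ?u1 ?mat2E ?mul1r.
move=> O i sO gO; set y := weyl_conj O i => hy [f0 f1 f2 f3].
have [uy|uy] : (val y).2 = mat2 1 0 0 1 \/ (val y).2 = mat2 (-1) 0 2 1.
  move: f0 f1; pattern (val y).2; apply: linear_part_ind; rewrite !mat2E;
  by [left | right | lia].
  by rewrite (vanishing_transl sO uy) in gO.
have [t et] : exists t, (y ^ t)%g = x; last by exists t, z; rewrite et.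
have {}f2 : 1 * (val y).1 0 0 + 1 * (val y).1 1 0 = l.
  apply: Zp_int_inj f2; first by rewrite /N addn2.
  by move: hy; rewrite /l /N /transl_size; lia.
by apply: refl1_conj; rewrite // -[RHS]f2 !mul1r.
Qed.

(** As for s_1, with the functional (2, 1) fixed by s_2. *)
Lemma separate_refl2 O1 z : O1 \in s -> (val (rep O1 ^ z)%g).2 = mat2 1 1 0 (-1) ->
    g O1 = 0.
Proof.
move=> s1; set x := (rep O1 ^ z)%g => u1.
pose N := (2 * (size_bound + transl_size x) + 2)%N.
pose l := 2 * (val x).1 0 0 + (val x).1 1 0.
apply: (@isolate_orbit 2 1 N l (parity x)) => //.
  by exists z; rewrite -/x; split; rewrite ?u1 ?mat2E ?mul1r.
move=> O i sO gO; set y := weyl_conj O i => hy [f0 f1 f2 f3].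
have [uy|uy] : (val y).2 = mat2 1 0 0 1 \/ (val y).2 = mat2 1 1 0 (-1).
  move: f0 f1; pattern (val y).2; apply: linear_part_ind; rewrite !mat2E;
  by [left | right | lia].
  by rewrite (vanishing_transl sO uy) in gO.
have [t et] : exists t, (y ^ t)%g = x; last by exists t, z; rewrite et.
have {}f2 : 2 * (val y).1 0 0 + 1 * (val y).1 1 0 = l.
  apply: Zp_int_inj f2; first by rewrite /N addn2.
  by move: hy; rewrite /l /N /transl_size; lia.
by apply: refl2_conj; rewrite // -[RHS]f2 !mul1r.
Qed.

Definition vanishing_at (k : nat) := forall O z, O \in s -> (rep O ^ z)%g =
    elliptic k -> g O = 0.

Lemma isolate_elliptic psi k : annihilates psi -> (forall w z, psi (w ^ z)%g = psi w) ->
  psi (elliptic k) != 0 -> (forall i, (i < 5)%N -> i <> k -> psi (elliptic i) =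
      0 \/ vanishing_at i) ->
  vanishing_at k.
Proof.
move=> nl cf pk h O1 z1 s1 e1.
apply: (isolate nl s1); first by rewrite -(cf _ z1) e1.
move=> O sO gO pO.
have gN : g O <> 0 by apply/eqP.
case: (conj_typeP (rep O)) => [u|z u|z u|z i i5 e].
- by case: gN; apply: separate_transl.
- by case: gN; apply: separate_refl1 u.
- by case: gN; apply: separate_refl2 u.
case: (eqVneq i k) => [ik|/eqP ik]; first by apply: (@rep_conj_eq _ _ z z1);
    rewrite // e e1 ik.
case: (h i i5 ik) => [p0|d]; last by case: gN; apply: d e.
by rewrite -(cf _ z) e p0 in pO.
Qed.

(** The traces on the zero functionals separate the five elliptic classes: each step
    isolates one class by a combination that vanishes on those not yet treated. *)
Lemma vanishing_elliptic k : (k < 5)%N -> vanishing_at k.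
Proof.
pose P b1 b2 b2' c w := at1 (zero_trace b1 b2 b2' c w).
have nP b1 b2 b2' (c : bool) : (c -> b2 = b2') -> annihilates (P b1 b2 b2' c).
  by move=> cb; apply: rel; apply: zero_trace_like.
have cP b1 b2 b2' (c : bool) : (c -> b2 = b2') -> forall w z,
    P b1 b2 b2' c (w ^ z)%g = P b1 b2 b2' c w.
  by move=> cb w z; apply: zero_trace_conj.
have V b1 b2 b2' (c : bool) (cb : c -> b2 = b2') :
    ((P b1 b2 b2' c (elliptic 0) = (~~ c)%:R *
        ((-1) ^+ b1 * (-1) ^+ b2 + (-1) ^+ b1 * (-1) ^+ b2')) *
    (P b1 b2 b2' c (elliptic 1) = (~~ c)%:R * 2) *
    (P b1 b2 b2' c (elliptic 2) = (~~ c)%:R * (2 * (-1) ^+ b2 * (-1) ^+ b2'))) *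
    ((P b1 b2 b2' c (elliptic 3) = c%:R * (2 * (-1) ^+ b1)) *
    (P b1 b2 b2' c (elliptic 4) = c%:R * ((-1) ^+ b2 + (-1) ^+ b2'))).
  by case: (zero_trace_values b1 cb).
(* The combinations take the values (4,0,0,0,0), (2,4,0,0,0), (2,2,2,0,0),
   (0,0,0,4,0) and (0,0,0,2,2) on the five representatives. *)
have d0 : vanishing_at 0.
  apply: (@isolate_elliptic (fun w => P false false false false w - P true false
      false false w)).
  - by apply: annihilates_sub; apply: nP.
  - by move=> w z; rewrite !cP.
  - by rewrite !V.
  - by move=> [|[|[|[|[|i]]]]] // _ _; left; rewrite !V.
have d1 : vanishing_at 1.
  apply: (@isolate_elliptic (fun w => P false false false false w + P false false
      true false w)).
  - by apply: annihilates_add; apply: nP.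
  - by move=> w z; rewrite !cP.
  - by rewrite !V.
  - by move=> [|[|[|[|[|i]]]]] // _ _; try (by right); left; rewrite !V.
have d2 : vanishing_at 2.
  apply: (@isolate_elliptic (P false false false false)).
  - exact: nP.
  - by move=> w z; rewrite !cP.
  - by rewrite !V.
  - by move=> [|[|[|[|[|i]]]]] // _ _; try (by right); left; rewrite !V.
have d3 : vanishing_at 3.
  apply: (@isolate_elliptic (fun w => P false false false true w + P false true true
      true w)).
  - by apply: annihilates_add; apply: nP.
  - by move=> w z; rewrite !cP.
  - by rewrite !V.
  - by move=> [|[|[|[|[|i]]]]] // _ _; try (by right); left; rewrite !V.
have d4 : vanishing_at 4.
  apply: (@isolate_elliptic (P false false false true)).
  - exact: nP.
  - by move=> w z; rewrite !cP.
  - by rewrite !V.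
  - by move=> [|[|[|[|[|i]]]]] // _ _; try (by right); left; rewrite !V.
by case: k => [|[|[|[|[|k]]]]].
Qed.

Lemma separation : {in s, forall O, g O = 0}.
Proof.
move=> O sO; case: (conj_typeP (rep O)) => [u|z u|z u|z i i5 e].
- exact: separate_transl.
- exact: separate_refl1 u.
- exact: separate_refl2 u.
- exact: (vanishing_elliptic i5) e.
Qed.
End Separation.

(** * The cocenter *)

Lemma val_transl_conj mu (y : affW) : val (transl mu ^ y)%g = ((val y).2^-1 *m mu, 1).
Proof.
have uy : (val y).2 \is a GRing.unit by apply: weyl_unit (valP y).
rewrite conjgE !val_mul val_transl /= mul1mx mul1r mulVr //; congr pair.
by rewrite mulmxDr addrC addrK.
Qed.

Lemma transl_orbitE mu : transl_orbit mu = conj_class (transl mu).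
Proof.
apply/seteqP; split=> [_ [w hw <-]|_ [y _ <-]].
  exists (aff 0 (weylV (mem_set hw))) => //; apply: val_inj;
      rewrite val_transl_conj val_transl.
  by rewrite /= invrK.
exists (val y).2^-1; first exact/set_mem/weylV/(valP y).
by apply: val_inj; rewrite val_transl_conj.
Qed.

Section CommSubmod.
Variable H : algType laurent.
Implicit Types h k : H.

Lemma comm_submod0 : comm_submod (0 : H).
Proof. by exists [::]; rewrite big_nil. Qed.

Lemma comm_submodD h k : comm_submod h -> comm_submod k -> comm_submod (h + k).
Proof. by move=> [s ->] [t ->]; exists (s ++ t); rewrite big_cat. Qed.

Lemma comm_submodZ a h : comm_submod h -> comm_submod (a *: h).
Proof.
move=> [s ->]; exists [seq (a * t.1, t.2) | t <- s].
by rewrite big_map scaler_sumr; apply: eq_bigr => t _; rewrite scalerA.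
Qed.

Lemma comm_submodN h : comm_submod h -> comm_submod (- h).
Proof. by rewrite -scaleN1r; apply: comm_submodZ. Qed.

Lemma comm_submodC h k : comm_submod (h * k - k * h).
Proof. by exists [:: (1, (h, k))]; rewrite big_seq1 scale1r. Qed.
End CommSubmod.

Section Cocenter.
Variables (H : algType laurent) (T : affW -> H) (hT : is_hecke_algebra T).

(** If sx < x and sxs has the length of x, then T_x = T_s T_{sx} and
    T_{sxs} = T_{sx} T_s. *)
Lemma comm_conj_down i x : descent i x -> alen (srefl i * x * srefl i)%g = alen x ->
  comm_submod (T x - T (srefl i * x * srefl i)%g).
Proof.
move=> di Lx; have := alen_srefl i x; rewrite di => Ld.
have -> : T x = T (srefl i) * T (srefl i * x)%g by rewrite (T_mul hT) sreflK //
    alen_srefl1 Ld.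
have -> : T (srefl i * x * srefl i)%g = T (srefl i * x)%g * T (srefl i).
  by rewrite (T_mul hT) // alen_srefl1 Lx Ld addn1.
exact: comm_submodC.
Qed.

Lemma transl_conj_srefl i mu : i <> G0 ->
  (srefl i * transl mu * srefl i)%g = transl ((val (srefl i)).2 *m mu).
Proof.
move=> i0; have t0 : (val (srefl i)).1 = 0 by rewrite val_srefl; case:
    (i) i0 => // _; rewrite -vec2_0.
have u2 : (val (srefl i)).2 * (val (srefl i)).2 = 1.
  by rewrite -[LHS]/(val (srefl i * srefl i)%g).2 -[X in (_ * X)%g]mulg1 sreflK.
apply: val_inj; rewrite !val_mul !val_transl [_.1]/= [_.2]/=
    t0 add0r mulmx0 addr0 mulr1.
by rewrite u2.
Qed.

Lemma walls_below_scaled a r : (0 <= r < 4) -> walls_below (4 * a + r) = absz a.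
Proof. by rewrite /walls_below; lia. Qed.

Lemma alen_transl a b : alen (transl (vec2 a b)) =
  (absz a + absz b + absz (a + b)%R + absz (2 * a + b)%R)%N.
Proof.
rewrite /alen /base_a /base_b val_transl mat2_1 !vec2E !mat2E.
rewrite -[absz a](@walls_below_scaled a 1) // -[absz b](@walls_below_scaled b 1) //.
rewrite -(@walls_below_scaled (a + b) 2) // -(@walls_below_scaled (2 * a + b) 3) //.
by congr (walls_below _ + walls_below _ + walls_below _ + walls_below _)%N; ring.
Qed.

Lemma alen_transl_refl i mu : i <> G0 -> alen (transl ((val (srefl i)).2 *m mu)) =
    alen (transl mu).
Proof.
rewrite [mu]vec2_eta val_srefl; case: i => // _; rewrite mat2_vec2 !alen_transl;
  move: (mu 0 0) (mu 1 0) => a b.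
  have -> : -1 * a + 0 * b = - a by ring.
  have -> : 2 * a + 1 * b = 2 * a + b by ring.
  have -> : - a + (2 * a + b) = a + b by ring.
  have -> : 2 * - a + (2 * a + b) = b by ring.
  by rewrite abszN; lia.
have -> : 0 * a + -1 * b = - b by ring.
have -> : 1 * a + 1 * b = a + b by ring.
have -> : a + b - b = a by ring.
have -> : 2 * (a + b) - b = 2 * a + b by ring.
by rewrite abszN; lia.
Qed.

(** The length is the same at both translations, and s is a left descent of one of them
    unless they coincide. *)
Lemma descent_transl i mu : i <> G0 -> [|| descent i (transl mu),
  descent i (transl ((val (srefl i)).2 *m mu)) | (val (srefl i)).2 *m mu == mu].
Proof.
rewrite [mu]vec2_eta val_srefl; move: (mu 0 0) (mu 1 0) => a b.
case: i => // _; rewrite /descent /base_a /base_b /= mat2_1 mat2_vec2 !vec2E !mat2E.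
  have [e|e] := eqVneq a 0; last by lia.
  apply/or3P; constructor 3; rewrite e; apply/eqP; congr vec2; lia.
have [e|e] := eqVneq b 0; last by lia.
apply/or3P; constructor 3; rewrite e; apply/eqP; congr vec2; lia.
Qed.

Lemma comm_transl_srefl i mu : i <> G0 ->
  comm_submod (T (transl mu) - T (transl ((val (srefl i)).2 *m mu))).
Proof.
move=> i0; have Li := alen_transl_refl mu i0.
have := transl_conj_srefl mu i0.
have := transl_conj_srefl ((val (srefl i)).2 *m mu) i0.
have -> : (val (srefl i)).2 *m ((val (srefl i)).2 *m mu) = mu.
  rewrite mulmxA mulmxE -[X in X *m _]/(val (srefl i * srefl i)%g).2.
  by rewrite -[X in (_ * X)%g]mulg1 sreflK /= mul1mx.
case/or3P: (descent_transl mu i0) => [di|di|/eqP->].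
- by move=> _ e; rewrite -e; apply: comm_conj_down; rewrite ?e.
- move=> e _; rewrite -opprB; apply: comm_submodN; rewrite -[X in _ - T X]e.
  by apply: comm_conj_down; rewrite ?e.
- by move=> _ _; rewrite subrr; apply: comm_submod0.
Qed.

(** An element of W is a product of simple reflections, each of which changes the
    basis element by a commutator. *)
Lemma comm_transl u mu : u \in weyl ->
  comm_submod (T (transl mu) - T (transl (u *m mu))).
Proof.
move=> /set_mem[rs hrs ->]; elim: rs hrs => [_|r rs IH /= /andP[hr /IH {}IH]].
  by rewrite big_nil mul1mx subrr; apply: comm_submod0.
rewrite big_cons -mulmxE -mulmxA; set nu := _ *m mu in IH *.
have [i i0 ->] : exists2 i, i <> G0 & r = (val (srefl i)).2.
  move: hr; rewrite /is_refl !inE => /orP[] /eqP ->; [exists G1 | exists G2] => //.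
    by rewrite val_srefl refl1E.
  by rewrite val_srefl refl2E.
rewrite -(subrK (T (transl nu)) (T (transl mu))) -addrA; apply: comm_submodD => //.
exact: comm_transl_srefl.
Qed.

Variables (rep : set affW -> affW).
Hypothesis hrep : forall O, conj_classes O -> min_len O (rep O).

(** The images of the T_O are linearly independent in the cocenter: a relation is
    annihilated by all trace functions, and these separate the classes at v = 1. *)
Lemma cocenter_free (s : seq (set affW)) (f : set affW -> laurent) :
    uniq s -> {in s, forall O, conj_classes O} ->
    comm_submod (\sum_(O <- s) f O *: T (rep O)) -> {in s, forall O, f O = 0}.
Proof.
move=> us hs cf.
have hr : {in s, forall O, O (rep O)} by move=> O /hs /hrep [].
apply: (@lifting_independence _ s {phi | trace_like hT phi}
    (fun t O => sval t (rep O))).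
  move=> g rel O sO; apply: (separation (hT := hT) us hs hr _ sO) => phi tr.
  exact: (rel (exist _ phi tr)).
move=> [phi tr] /=; have := trace_like_comm tr cf.
rewrite linext_sum => e; rewrite -[RHS]e.
by apply: eq_bigr => O _; rewrite linextZ linext_basis.
Qed.
End Cocenter.

Theorem proposition3p16 (H : algType laurent) (T : affW -> H)
    (hT : is_hecke_algebra T)
    (rep : set affW -> affW)
    (hrep : forall O, conj_classes O -> min_len O (rep O))
    (lam : latP) (hlam : latQplus lam)
    (w : affW) (hw : transl_orbit lam w)
    (O : set affW) (hO : conj_classes O) :
  vdeg (class_poly T rep w O) =
    if `[< O = transl_orbit lam >] then 0%:E else -oo%E.
Proof.
set Ol := transl_orbit lam in hw *.
have cl : conj_classes Ol by rewrite /Ol transl_orbitE; exists (transl lam).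
pose d (P : set affW) : laurent := if `[< P = Ol >] then 1 else 0.
have dN P : P <> Ol -> d P = 0 by move=> ne; rewrite /d asboolF.
have dl : d Ol = 1 by rewrite /d asboolT.
have fsumE (f : set affW -> laurent) (s : seq (set affW)) : uniq s ->
    {in s, forall P, conj_classes P} -> (forall P, conj_classes P -> f P != 0 ->
        P \in s) ->
    \sum_(P \in conj_classes) f P *: T (rep P) = \sum_(P <- s) f P *: T (rep P).
  move=> us hs fs; rewrite (fsbigE s) //.
    by rewrite big_seq_cond [RHS]big_seq; apply: eq_bigl => P; case:
        (boolP (P \in s)) => // /hs /mem_set ->.
  move=> P cP /negP Ps; case: (eqVneq (f P) 0) => [->|/(fs P cP) //];
      by rewrite scale0r.
have dC : cocenter_coords T rep w d.
  split.
  - by move=> P ncP; apply: dN => e; apply: ncP; rewrite e.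
  - apply: (@sub_finite_set _ _ [set Ol]); last exact: finite_set1.
    by move=> P /= ; apply: contra_neqP => /dN.
  - rewrite (fsumE d [:: Ol]) //.
    + rewrite big_seq1 dl scale1r.
      have [u hu <-] := hw; have [[u' hu' <-] _] := hrep Ol cl.
      have := comm_transl hT lam (mem_set hu) => /comm_submodN.
      rewrite opprB => h; have := comm_submodD h (comm_transl hT lam (mem_set hu')).
      by rewrite addrA subrK.
    + by move=> P; rewrite inE => /eqP ->.
    + by move=> P _; rewrite inE; apply: contra_neqT => /eqP /dN.
have -> : class_poly T rep w = d.
  apply: xget_unique => // f [f0 ffin fC].
  have /finite_seqP[r rE] := ffin.
  pose s := undup (Ol :: r).
  have inr P : f P != 0 -> P \in r.
    by move=> fP; have : [set P | f P != 0] P by []; rewrite rE.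
  have rfP P : P \in r -> f P != 0.
    by move=> Pr; have : [set` r] P by []; rewrite -rE.
  have sP : {in s, forall P, conj_classes P}.
    move=> P; rewrite mem_undup inE => /orP[/eqP->//|/rfP fP].
    by apply: contrapT => /f0 fP0; rewrite fP0 eqxx in fP.
  have us : uniq s by exact: undup_uniq.
  have key : {in s, forall P, f P - d P = 0}.
    apply: (cocenter_free hT hrep us sP (f := fun P => f P - d P)).
    have [_ _ dC'] := dC.
    rewrite (fsumE d s us sP) in dC'; last first.
      move=> P _; rewrite mem_undup inE; case: (eqVneq P Ol) => [//|/eqP ne].
      by rewrite dN ?eqxx.
    rewrite (fsumE f s us sP) in fC; last first.
      by move=> P _ /inr Pr; rewrite mem_undup inE Pr orbT.
    have := comm_submodD dC' (comm_submodN fC).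
    rewrite opprB addrC addrA subrK -sumrB.
    by under eq_bigr do rewrite -scalerBl.
  apply/funext => P; case: (boolP (P \in s)) => [/key /eqP|Ps].
    by rewrite subr_eq0 => /eqP.
  move: Ps; rewrite mem_undup inE negb_or => /andP[/eqP /dN -> Pr].
  by apply/eqP; apply: contraNT Pr => /inr.
have vd (c : int) : vdeg (c%:~R) = poly_deg c%:P.
  apply: xget_unique.
    by exists c%:P => //=; rewrite map_polyC hornerC.
  move=> _ [p /= hp <-]; congr poly_deg; apply/eqP; rewrite -subr_eq0; apply/eqP.
  by apply: lxi_transcendental; rewrite rmorphB /=
      map_polyC hornerD hornerN hornerC -hp subrr.
rewrite /d; case: asboolP => _.
  by rewrite (vd 1) /poly_deg polyC_eq0 oner_eq0 size_polyC oner_eq0.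
by rewrite (vd 0) /poly_deg polyC_eq0 eqxx.
Qed.
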